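(* Let $X$ be a path-connected space and $x_0\in X$. For any subgroup $H\subseteq\pi_1(X,x_0)$, give $\widetilde{X}_H$ the whisker topology. The following are equivalent: (1) $H$ is an $\mathbf{lpc}_0$-covering subgroup of $\pi_1(X,x_0)$; (2) $p_H:\widetilde{X}_H\to X$ is an $\mathbf{lpc}_0$-covering; (3) $p_H:\widetilde{X}_H\to X$ has the unique path lifting property; (4) $(p_H)_*(\pi_1(\widetilde{X}_H,\tilde{x}_H))=H$.
   Context: Maps are continuous functions. $\mathbf{lpc}_0$ is the category of path-connected, locally path-connected spaces. An $\mathbf{lpc}_0$-covering map is a map $p:\widetilde{X}\to X$ such that $\widetilde{X}$ is path-connected and locally path-connected, and for every path-connected, locally path-connected space $Y$, every $\tilde{x}\in\widetilde{X}$, $y\in Y$, and every based map $f:(Y,y)\to(X,p(\tilde{x}))$ with $f_*(\pi_1(Y,y))\subseteq p_*(\pi_1(\widetilde{X},\tilde{x}))$, there is a unique map $\tilde{f}:(Y,y)\to(\widetilde{X},\tilde{x})$ with $p\circ\tilde{f}=f$. A subgroup $H\subseteq\pi_1(X,x_0)$ is an $\mathbf{lpc}_0$-covering subgroup if there is an $\mathbf{lpc}_0$-covering map $p:(\widetilde{X},\tilde{x})\to(X,x_0)$ with $p_*(\pi_1(\widetilde{X},\tilde{x}))=H$. A map $f:E\to X$ has the unique path lifting property if for any two paths $\alpha,\beta:[0,1]\to E$, $\alpha=\beta$ whenever $f\circ\alpha=f\circ\beta$ and $\alpha(0)=\beta(0)$. For a subgroup $H\subseteq\pi_1(X,x_0)$,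 $\widetilde{X}_H$ is the set of equivalence classes $[\alpha]_H$ of paths $\alpha:[0,1]\to X$ with $\alpha(0)=x_0$, where $\alpha\sim\beta$ iff $\alpha(1)=\beta(1)$ and $[\alpha\cdot\beta^-]\in H$ ($\beta^-$ is the reverse path and $\cdot$ is concatenation). The whisker topology on $\widetilde{X}_H$ is generated by the sets $B([\alpha]_H,U)=\{[\alpha\cdot\epsilon]_H : \epsilon \text{ a path with } \epsilon(0)=\alpha(1),\ \epsilon([0,1])\subseteq U\}$, where $U$ is an open neighborhood of $\alpha(1)$ in $X$. The basepoint is $\tilde{x}_H=[c_{x_0}]_H$, the class of the constant path at $x_0$, and $p_H:\widetilde{X}_H\to X$ is the endpoint projection $p_H([\alpha]_H)=\alpha(1)$, which is continuous. *)

(* Defs.v *)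
(* Paths are parametrized by the unit interval of an arbitrary R : realType. *)
From HB Require Import structures.
From mathcomp Require Import all_boot all_order all_algebra generic_quotient.
From mathcomp Require Import all_classical reals topology normedtype.
From mathcomp Require Import homotopy.
From mathcomp Require Import ring lra.

Set Implicit Arguments.
Unset Strict Implicit.
Unset Printing Implicit Defensive.

Import Order.TTheory GRing.Theory Num.Theory.
Import numFieldNormedType.Exports.

Local Open Scope classical_set_scope.
Local Open Scope ring_scope.
Local Open Scope quotient_scope.

Section unit_interval.
Variable R : realType.

Definition unit_itv : Type := set_type (`[0%R, 1%R] : set R).
HB.instance Definition _ :=
  Topological.copy unit_itv (set_type (`[0%R, 1%R] : set R)).

Definition itv_val (s : unit_itv) : R := set_val s.

Lemma itv_val_ge0 s : 0 <= itv_val s.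
Proof. by have /set_mem/= := valP s; rewrite in_itv/= => /andP[]. Qed.

Lemma itv_val_le1 s : itv_val s <= 1.
Proof. by have /set_mem/= := valP s; rewrite in_itv/= => /andP[]. Qed.

Lemma itv_val_inj : injective itv_val. Proof. exact: val_inj. Qed.

Lemma continuous_itv_val : continuous itv_val.
Proof. exact: initial_continuous. Qed.

Lemma clamp_subproof (x : R) : Num.max 0 (Num.min 1 x) \in `[0%R, 1%R]%classic.
Proof.
by apply/mem_set; rewrite /= in_itv/= le_max ge_max lexx ler01 ge_min lexx.
Qed.

(* The retraction of R onto the unit interval; it only serves to reinject real
   numbers that are already known to be in [0, 1]. *)
Definition clamp (x : R) : unit_itv := SigSub (clamp_subproof x).

Lemma clampE x : itv_val (clamp x) = Num.max 0 (Num.min 1 x). Proof. by []. Qed.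

Lemma clampK : cancel itv_val clamp.
Proof.
move=> s; apply: itv_val_inj; rewrite clampE.
by rewrite min_r ?itv_val_le1// max_r ?itv_val_ge0.
Qed.

Lemma clamp_id x : 0 <= x -> x <= 1 -> itv_val (clamp x) = x.
Proof. by move=> x0 x1; rewrite clampE min_r// max_r. Qed.

Lemma continuous_clamp : continuous clamp.
Proof.
apply: (@continuous_comp_initial _ _ _ (set_val : unit_itv -> R)) => x /=.
have cmin : {for x, continuous (fun y : R => Num.min 1 y : R^o)}.
  by apply: (@continuous_min R R (cst 1) id); [exact: cvg_cst | exact: cvg_id].
by apply: (@continuous_max R R (cst 0) (fun y => Num.min 1 y)); first exact: cvg_cst.
Qed.

Lemma clamp01_neq : clamp 0 != clamp 1.
Proof.
by apply/eqP => /(congr1 itv_val)/eqP; rewrite !clamp_id ?ler01// eq_sym oner_eq0.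
Qed.

HB.instance Definition _ := isBiPointed.Build unit_itv clamp01_neq.

Lemma itv_val0 : itv_val zero = 0. Proof. by rewrite clamp_id ?ler01. Qed.
Lemma itv_val1 : itv_val one = 1. Proof. by rewrite clamp_id ?ler01. Qed.

Lemma clamp_le0 x : x <= 0 -> clamp x = zero.
Proof.
move=> x0; apply: itv_val_inj; rewrite itv_val0 clampE min_r ?max_l//.
exact: le_trans x0 ler01.
Qed.

Lemma clamp_ge1 x : 1 <= x -> clamp x = one.
Proof. by move=> x1; apply: itv_val_inj; rewrite itv_val1 clampE min_l ?max_r. Qed.

Lemma continuous_pasting (S T : topologicalType) (h : S -> R) (c : R)
    (f g : S -> T) :
  continuous h -> continuous f -> continuous g ->
  (forall s, h s = c -> f s = g s) ->
  continuous (fun s => if h s <= c then f s else g s).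
Proof.
move=> ch cf cg fg s; case: (ltgtP (h s) c) => hs.
- have near_lt : \forall s' \near s, h s' < c.
    by apply: (ch s [set y | y < c]); exact: lt_nbhsl.
  rewrite /continuous_at (ltW hs).
  apply: cvg_trans (cf s); apply: near_eq_cvg.
  by near=> s'; rewrite ifT//; apply: ltW; near: s'.
- have near_gt : \forall s' \near s, c < h s'.
    by apply: (ch s [set y | c < y]); exact: lt_nbhsr.
  rewrite /continuous_at leNgt hs/=.
  apply: cvg_trans (cg s); apply: near_eq_cvg.
  by near=> s'; rewrite leNgt ifF//; apply/negbTE; rewrite negbK; near: s'.
- rewrite /continuous_at hs lexx => A As.
  have Af : nbhs s (f @^-1` A) by exact: cf.
  have Ag : nbhs s (g @^-1` A) by apply: cg; rewrite -fg.
  by apply: filterS2 Af Ag => s' /= Af Ag; case: ifP.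
Unshelve. all: by end_near. Qed.

End unit_interval.

Section paths.
Context {R : realType} {X : topologicalType}.
Local Notation I := (unit_itv R).
Implicit Types x y z w : X.

Let continuous_clampM (S : topologicalType) (h : S -> R) (a : R) :
  continuous h -> continuous (fun s => clamp (a * h s)).
Proof.
move=> ch s; apply: (@continuous_comp _ _ _ (fun s => a * h s) (@clamp R)).
  by apply: cvgM; [exact: cvg_cst | exact: ch].
exact: continuous_clamp.
Qed.

Let continuous_clampM1 (S : topologicalType) (h : S -> R) (a : R) :
  continuous h -> continuous (fun s => clamp (a * h s - 1)).
Proof.
move=> ch s; apply: (@continuous_comp _ _ _ (fun s => a * h s - 1) (@clamp R)).
  by apply: cvgB; [apply: cvgM; [exact: cvg_cst | exact: ch] | exact: cvg_cst].
exact: continuous_clamp.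
Qed.

Let continuous_clamp1B (S : topologicalType) (h : S -> R) :
  continuous h -> continuous (fun s => clamp (1 - h s)).
Proof.
move=> ch s; apply: (@continuous_comp _ _ _ (fun s => 1 - h s) (@clamp R)).
  by apply: cvgB; [exact: cvg_cst | exact: ch].
exact: continuous_clamp.
Qed.

Let continuous_pair2 (S T U V : topologicalType) (F : T * U -> V)
    (f : S -> T) (g : S -> U) :
  continuous F -> continuous f -> continuous g -> continuous (fun s => F (f s, g s)).
Proof.
move=> cF cf cg s; apply: (@continuous_comp _ _ _ (fun s => (f s, g s)) F).
  by apply: cvg_pair; [exact: cf | exact: cg].
exact: cF.
Qed.

Let continuous_compT (S T U : topologicalType) (g : T -> U) (f : S -> T) :
  continuous g -> continuous f -> continuous (fun s => g (f s)).
Proof. by move=> cg cf s; apply: continuous_comp; [exact: cf | exact: cg]. Qed.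

Definition cat_fun (a b : I -> X) (s : I) : X :=
  if itv_val s <= 2^-1 then a (clamp (2 * itv_val s))
  else b (clamp (2 * itv_val s - 1)).

Section cat.
Context x y z (a : {path I from x to y in X}) (b : {path I from y to z in X}).

Let cat_cts : continuous (cat_fun a b).
Proof.
apply: continuous_pasting => [|||s ->].
- exact: continuous_itv_val.
- by apply: continuous_compT; [exact: cts_fun | exact/continuous_clampM/continuous_itv_val].
- by apply: continuous_compT; [exact: cts_fun | exact/continuous_clampM1/continuous_itv_val].
- by rewrite clamp_ge1 ?clamp_le0 ?path_zero ?path_one//; lra.
Qed.

Let cat_zero : cat_fun a b zero = x.
Proof. by rewrite /cat_fun itv_val0 invr_ge0 ler0n clamp_le0 ?path_zero//; lra. Qed.

Let cat_one : cat_fun a b one = z.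
Proof.
rewrite /cat_fun itv_val1 ifF ?clamp_ge1 ?path_one//; first by lra.
by apply/negbTE; rewrite -ltNge; lra.
Qed.

Definition path_cat : {path I from x to z in X} := mk_path cat_cts cat_zero cat_one.

Let rev_cts : continuous (fun s : I => a (clamp (1 - itv_val s))).
Proof.
by apply: continuous_compT; [exact: cts_fun | exact/continuous_clamp1B/continuous_itv_val].
Qed.

Let rev_zero : a (clamp (1 - itv_val zero)) = y.
Proof. by rewrite itv_val0 clamp_ge1 ?path_one//; lra. Qed.

Let rev_one : a (clamp (1 - itv_val one)) = x.
Proof. by rewrite itv_val1 clamp_le0 ?path_zero//; lra. Qed.

Definition path_rev : {path I from y to x in X} := mk_path rev_cts rev_zero rev_one.

End cat.

Lemma path_catE x y z (a : {path I from x to y in X})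
    (b : {path I from y to z in X}) (s : I) :
  path_cat a b s = if itv_val s <= 2^-1 then a (clamp (2 * itv_val s))
                   else b (clamp (2 * itv_val s - 1)).
Proof. by []. Qed.

Lemma path_revE x y (a : {path I from x to y in X}) (s : I) :
  path_rev a s = a (clamp (1 - itv_val s)).
Proof. by []. Qed.

Definition path_cst x : {path I from x to x in X} := cst x.

(* The second coordinate is the deformation parameter; the endpoints stay
   fixed. *)
Definition path_homotopic x y (a b : {path I from x to y in X}) : Prop :=
  exists F : I * I -> X,
    [/\ continuous F,
        forall s, F (s, zero) = a s,
        forall s, F (s, one) = b s,
        forall t, F (zero, t) = x &
        forall t, F (one, t) = y].

Lemma homotopic_reparam x y (a b : {path I from x to y in X}) (c : I -> X)
    (phi psi : R -> R) :
  continuous c -> continuous phi -> continuous psi ->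
  phi 0 = psi 0 -> phi 1 = psi 1 ->
  (forall s, a s = c (clamp (phi (itv_val s)))) ->
  (forall s, b s = c (clamp (psi (itv_val s)))) ->
  path_homotopic a b.
Proof.
move=> cc cphi cpsi pp0 pp1 aE bE.
exists (fun p => c (clamp ((1 - itv_val p.2) * phi (itv_val p.1) +
                           itv_val p.2 * psi (itv_val p.1)))).
have cc1 : continuous (fun p : I * I => itv_val p.1).
  by apply: continuous_compT; [exact: continuous_itv_val | move=> ?; exact: cvg_fst].
have cc2 : continuous (fun p : I * I => itv_val p.2).
  by apply: continuous_compT; [exact: continuous_itv_val | move=> ?; exact: cvg_snd].
split => [|s|s|t|t] /=.
- apply: continuous_compT => //; apply: continuous_compT; first exact: continuous_clamp.
  move=> p; apply: cvgD; apply: cvgM.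
  + by apply: cvgB; [exact: cvg_cst | exact: cc2].
  + exact: (continuous_compT cphi cc1).
  + exact: cc2.
  + exact: (continuous_compT cpsi cc1).
- by rewrite itv_val0 aE; congr (c (clamp _)); ring.
- by rewrite itv_val1 bE; congr (c (clamp _)); ring.
- by rewrite -[RHS](path_zero (s := a)) aE itv_val0 -pp0; congr (c (clamp _)); ring.
- by rewrite -[RHS](path_one (s := a)) aE itv_val1 -pp1; congr (c (clamp _)); ring.
Qed.

Lemma homotopic_refl x y (a : {path I from x to y in X}) : path_homotopic a a.
Proof.
exists (fun p => a p.1); split => // [|t|t]; rewrite ?path_zero ?path_one//.
by apply: continuous_compT; [exact: cts_fun | move=> ?; exact: cvg_fst].
Qed.

Lemma homotopic_sym x y (a b : {path I from x to y in X}) :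
  path_homotopic a b -> path_homotopic b a.
Proof.
move=> [F [cF F0 F1 Fx Fy]]; exists (fun p => F (p.1, clamp (1 - itv_val p.2))).
split => // [|s|s].
- apply: continuous_pair2 => //; first by move=> ?; exact: cvg_fst.
  apply: continuous_clamp1B; apply: continuous_compT; first exact: continuous_itv_val.
  by move=> ?; exact: cvg_snd.
- by rewrite /= itv_val0 clamp_ge1 ?F1//; lra.
- by rewrite /= itv_val1 clamp_le0 ?F0//; lra.
Qed.

Lemma homotopic_trans x y (a b c : {path I from x to y in X}) :
  path_homotopic a b -> path_homotopic b c -> path_homotopic a c.
Proof.
move=> [F [cF F0 F1 Fx Fy]] [G [cG G0 G1 Gx Gy]].
exists (fun p => if itv_val p.2 <= 2^-1 then F (p.1, clamp (2 * itv_val p.2))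
                 else G (p.1, clamp (2 * itv_val p.2 - 1))).
have cc1 : continuous (fst : I * I -> I) by move=> ?; exact: cvg_fst.
have cc2 : continuous (fun p : I * I => itv_val p.2).
  by apply: continuous_compT; [exact: continuous_itv_val | move=> ?; exact: cvg_snd].
split => /= [|s|s|t|t].
- apply: continuous_pasting => // [||p ->].
  + by apply: continuous_pair2 => //; exact: continuous_clampM.
  + by apply: continuous_pair2 => //; exact: continuous_clampM1.
  + by rewrite clamp_ge1 ?clamp_le0 ?F1 ?G0//; lra.
- by rewrite itv_val0 invr_ge0 ler0n clamp_le0 ?F0//; lra.
- rewrite itv_val1 ifF ?clamp_ge1 ?G1//; first by lra.
  by apply/negbTE; rewrite -ltNge; lra.
- by case: ifP.
- by case: ifP.
Qed.

Lemma homotopic_cat x y z (a a' : {path I from x to y in X})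
    (b b' : {path I from y to z in X}) :
  path_homotopic a a' -> path_homotopic b b' ->
  path_homotopic (path_cat a b) (path_cat a' b').
Proof.
move=> [F [cF F0 F1 Fx Fy]] [G [cG G0 G1 Gx Gy]].
exists (fun p => if itv_val p.1 <= 2^-1 then F (clamp (2 * itv_val p.1), p.2)
                 else G (clamp (2 * itv_val p.1 - 1), p.2)).
have cc2 : continuous (snd : I * I -> I) by move=> ?; exact: cvg_snd.
have cc1 : continuous (fun p : I * I => itv_val p.1).
  by apply: continuous_compT; [exact: continuous_itv_val | move=> ?; exact: cvg_fst].
split => /= [|s|s|t|t].
- apply: continuous_pasting => // [||p ->].
  + by apply: continuous_pair2 => //; exact: continuous_clampM.
  + by apply: continuous_pair2 => //; exact: continuous_clampM1.
  + by rewrite clamp_ge1 ?clamp_le0 ?Fy ?Gx//; lra.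
- by rewrite F0 G0.
- by rewrite F1 G1.
- by rewrite itv_val0 invr_ge0 ler0n clamp_le0 ?Fx//; lra.
- rewrite itv_val1 ifF ?clamp_ge1 ?Gy//; first by lra.
  by apply/negbTE; rewrite -ltNge; lra.
Qed.

Lemma homotopic_rev x y (a a' : {path I from x to y in X}) :
  path_homotopic a a' -> path_homotopic (path_rev a) (path_rev a').
Proof.
move=> [F [cF F0 F1 Fx Fy]]; exists (fun p => F (clamp (1 - itv_val p.1), p.2)).
split => /= [|s|s|t|t].
- apply: continuous_pair2 => //; last by move=> ?; exact: cvg_snd.
  apply: continuous_clamp1B; apply: continuous_compT; first exact: continuous_itv_val.
  by move=> ?; exact: cvg_fst.
- by rewrite F0.
- by rewrite F1.
- by rewrite itv_val0 clamp_ge1 ?Fy//; lra.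
- by rewrite itv_val1 clamp_le0 ?Fx//; lra.
Qed.

Lemma homotopic_catA x y z w (a : {path I from x to y in X})
    (b : {path I from y to z in X}) (c : {path I from z to w in X}) :
  path_homotopic (path_cat (path_cat a b) c) (path_cat a (path_cat b c)).
Proof.
apply: (@homotopic_reparam _ _ _ _ (path_cat a (path_cat b c))
  (fun v => Num.min (Num.min (2 * v) (v + 4^-1)) (2^-1 * (v + 1))) id).
- exact: cts_fun.
- move=> v.
  apply: (@continuous_min R R (fun v => Num.min (2 * v) (v + 4^-1))
    (fun v => 2^-1 * (v + 1))).
    apply: (@continuous_min R R (fun v => 2 * v) (fun v => v + 4^-1)).
      by apply: cvgM; [exact: cvg_cst | exact: cvg_id].
    by apply: cvgD; [exact: cvg_id | exact: cvg_cst].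
  apply: cvgM; first exact: cvg_cst.
  by apply: cvgD; [exact: cvg_id | exact: cvg_cst].
- by move=> v; exact: cvg_id.
- by rewrite min_l ?min_l//; lra.
- by rewrite min_r ?le_min//; lra.
- move=> s; have := itv_val_ge0 s; have := itv_val_le1 s.
  rewrite !path_catE.
  move: (itv_val s) => v v1 v0.
  have [v2|v2] := leP v 2^-1; last first.
    have -> : Num.min (Num.min (2 * v) (v + 4^-1)) (2^-1 * (v + 1)) = 2^-1 * (v + 1).
      by rewrite min_r// le_min; lra.
    rewrite clamp_id; [|lra|lra].
    rewrite ifF; last by lra.
    rewrite clamp_id; [|lra|lra].
    rewrite ifF; last by lra.
    by congr (c (clamp _)); lra.
  rewrite clamp_id; [|lra|lra].
  have [v4|v4] := leP (2 * v) 2^-1.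
    have -> : Num.min (Num.min (2 * v) (v + 4^-1)) (2^-1 * (v + 1)) = 2 * v.
      by rewrite min_l ?min_l//; lra.
    rewrite clamp_id; [|lra|lra].
    by rewrite ifT.
  have -> : Num.min (Num.min (2 * v) (v + 4^-1)) (2^-1 * (v + 1)) = v + 4^-1.
    by rewrite min_l min_r; lra.
  rewrite clamp_id; [|lra|lra].
  rewrite ifF; last by lra.
  rewrite clamp_id; [|lra|lra].
  rewrite ifT; last by lra.
  by congr (b (clamp _)); lra.
- by move=> s; rewrite clampK.
Qed.

Lemma homotopic_cat1p x y (a : {path I from x to y in X}) :
  path_homotopic (path_cat (path_cst x) a) a.
Proof.
apply: (@homotopic_reparam _ _ _ _ a (fun v => Num.max 0 (2 * v - 1)) id).
- exact: cts_fun.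
- move=> v; apply: (@continuous_max R R (cst 0) (fun v => 2 * v - 1)).
    exact: cvg_cst.
  by apply: cvgB; [apply: cvgM; [exact: cvg_cst | exact: cvg_id] | exact: cvg_cst].
- by move=> v; exact: cvg_id.
- by rewrite max_l//; lra.
- by rewrite max_r//; lra.
- move=> s; rewrite !path_catE.
  have [v2|v2] := leP (itv_val s) 2^-1.
    by rewrite max_l; [rewrite [clamp 0]clamp_le0 ?path_zero | lra].
  by rewrite max_r//; lra.
- by move=> s; rewrite clampK.
Qed.

Lemma homotopic_catp1 x y (a : {path I from x to y in X}) :
  path_homotopic (path_cat a (path_cst y)) a.
Proof.
apply: (@homotopic_reparam _ _ _ _ a (fun v => Num.min (2 * v) 1) id).
- exact: cts_fun.
- move=> v; apply: (@continuous_min R R (fun v => 2 * v) (cst 1)).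
    by apply: cvgM; [exact: cvg_cst | exact: cvg_id].
  exact: cvg_cst.
- by move=> v; exact: cvg_id.
- by rewrite min_l//; lra.
- by rewrite min_r//; lra.
- move=> s; rewrite !path_catE.
  have [v2|v2] := leP (itv_val s) 2^-1.
    by rewrite min_l//; lra.
  by rewrite min_r; [rewrite [clamp 1]clamp_ge1 ?path_one | lra].
- by move=> s; rewrite clampK.
Qed.

Lemma homotopic_catpV x y (a : {path I from x to y in X}) :
  path_homotopic (path_cat a (path_rev a)) (path_cst x).
Proof.
apply: (@homotopic_reparam _ _ _ _ a (fun v => Num.min (2 * v) (2 - 2 * v)) (fun=> 0)).
- exact: cts_fun.
- move=> v; apply: (@continuous_min R R (fun v => 2 * v) (fun v => 2 - 2 * v)).
    by apply: cvgM; [exact: cvg_cst | exact: cvg_id].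
  by apply: cvgB; [exact: cvg_cst | apply: cvgM; [exact: cvg_cst | exact: cvg_id]].
- by move=> v; exact: cvg_cst.
- by rewrite min_l/=; lra.
- by rewrite min_r/=; lra.
- move=> s; have := itv_val_ge0 s; have := itv_val_le1 s.
  rewrite !path_catE; move: (itv_val s) => v v1 v0.
  have [v2|v2] := leP v 2^-1; first by rewrite min_l//; lra.
  rewrite min_r; last by lra.
  rewrite ?path_revE clamp_id; [|lra|lra].
  by congr (a (clamp _)); lra.
- by move=> s; rewrite clamp_le0 ?path_zero.
Qed.

Lemma path_revK x y : cancel (@path_rev x y) (@path_rev y x).
Proof.
move=> a; apply/path_eqP => s; have := itv_val_ge0 s; have := itv_val_le1 s => s1 s0.
rewrite ?path_revE clamp_id; [|lra|lra].
by rewrite subKr clampK.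
Qed.

Lemma homotopic_catVp x y (a : {path I from x to y in X}) :
  path_homotopic (path_cat (path_rev a) a) (path_cst y).
Proof. by have := homotopic_catpV (path_rev a); rewrite path_revK. Qed.

Lemma path_rev_cat x y z (a : {path I from x to y in X})
    (b : {path I from y to z in X}) :
  path_rev (path_cat a b) = path_cat (path_rev b) (path_rev a).
Proof.
apply/path_eqP => s; have := itv_val_ge0 s; have := itv_val_le1 s => s1 s0.
rewrite path_revE !path_catE clamp_id; [|lra|lra].
have [s2|s2] := leP (itv_val s) 2^-1; last first.
  rewrite ifT; last by lra.
  rewrite path_revE clamp_id; [|lra|lra].
  by congr (a (clamp _)); lra.
rewrite path_revE clamp_id; [|lra|lra].
have [s2'|s2'] := leP (1 - itv_val s) 2^-1.
  by rewrite clamp_ge1 ?clamp_le0 ?path_one ?path_zero//; lra.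
by congr (b (clamp _)); lra.
Qed.

End paths.

Section fundamental_group.
Variable R : realType.
Local Notation I := (unit_itv R).

Section group.
Context {X : topologicalType} (x : X).
Local Notation loop := ({path I from x to x in X}).

Definition loop_homotopic : rel loop := fun a b => `[< path_homotopic a b >].

Let loop_homotopic_refl : reflexive loop_homotopic.
Proof. by move=> a; apply/asboolP; exact: homotopic_refl. Qed.

Let loop_homotopic_sym : symmetric loop_homotopic.
Proof. by move=> a b; apply/asboolP/asboolP; exact: homotopic_sym. Qed.

Let loop_homotopic_trans : transitive loop_homotopic.
Proof.
move=> b a c /asboolP ab /asboolP bc; apply/asboolP.
exact: homotopic_trans ab bc.
Qed.

Canonical loop_homotopic_equiv :=
  EquivRel loop_homotopic loop_homotopic_refl loop_homotopic_sym loop_homotopic_trans.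

Definition pi1 : Type := {eq_quot loop_homotopic_equiv}.
HB.instance Definition _ := Choice.on pi1.
HB.instance Definition _ := EqQuotient.on pi1.

Lemma pi1P (a b : loop) : (\pi_pi1 a = \pi_pi1 b) <-> path_homotopic a b.
Proof. by split=> [/eqmodP/asboolP|ab]; last exact/eqmodP/asboolP. Qed.

Lemma repr_pi1 (a : loop) : path_homotopic (repr (\pi_pi1 a)) a.
Proof. by apply/pi1P; rewrite reprK. Qed.

Definition pi1_one : pi1 := \pi_pi1 (path_cst x).
Definition pi1_mul (u v : pi1) : pi1 := \pi_pi1 (path_cat (repr u) (repr v)).
Definition pi1_inv (u : pi1) : pi1 := \pi_pi1 (path_rev (repr u)).

Lemma pi1_mulE (a b : loop) :
  pi1_mul (\pi_pi1 a) (\pi_pi1 b) = \pi_pi1 (path_cat a b).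
Proof. by apply/pi1P; apply: homotopic_cat; exact: repr_pi1. Qed.

Lemma pi1_invE (a : loop) : pi1_inv (\pi_pi1 a) = \pi_pi1 (path_rev a).
Proof. by apply/pi1P; apply: homotopic_rev; exact: repr_pi1. Qed.

Let pi1_mulA : associative pi1_mul.
Proof.
elim/quotW=> a; elim/quotW=> b; elim/quotW=> c.
rewrite (pi1_mulE b c) (pi1_mulE a b) !pi1_mulE.
by apply/pi1P; apply: homotopic_sym; exact: homotopic_catA.
Qed.

Let pi1_mul1g : left_id pi1_one pi1_mul.
Proof. by elim/quotW=> a; rewrite pi1_mulE; apply/pi1P; exact: homotopic_cat1p. Qed.

Let pi1_mulg1 : right_id pi1_one pi1_mul.
Proof. by elim/quotW=> a; rewrite pi1_mulE; apply/pi1P; exact: homotopic_catp1. Qed.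

Let pi1_mulVg : left_inverse pi1_one pi1_inv pi1_mul.
Proof.
by elim/quotW=> a; rewrite pi1_invE pi1_mulE; apply/pi1P; exact: homotopic_catVp.
Qed.

Let pi1_mulgV : right_inverse pi1_one pi1_inv pi1_mul.
Proof.
by elim/quotW=> a; rewrite pi1_invE pi1_mulE; apply/pi1P; exact: homotopic_catpV.
Qed.

HB.instance Definition _ :=
  isGroup.Build pi1 pi1_mulA pi1_mul1g pi1_mulg1 pi1_mulVg pi1_mulgV.

Lemma pi1_1 : (1%g : pi1) = \pi_pi1 (path_cst x). Proof. by []. Qed.

Lemma pi1M (a b : loop) :
  (\pi_pi1 a * \pi_pi1 b)%g = \pi_pi1 (path_cat a b) :> pi1.
Proof. exact: pi1_mulE. Qed.

Lemma pi1V (a : loop) : ((\pi_pi1 a)^-1)%g = \pi_pi1 (path_rev a) :> pi1.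
Proof. exact: pi1_invE. Qed.

End group.

Section induced_map.
Context {X Y : topologicalType} (f : continuousType X Y) (x : X) (y : Y).
Hypothesis fx : f x = y.

Section path_map.
Variable a : {path I from x to x in X}.

Let map_cts : continuous (f \o a).
Proof. by move=> s; apply: continuous_comp; exact: cts_fun. Qed.

Let map_zero : (f \o a) zero = y. Proof. by rewrite /= path_zero. Qed.
Let map_one : (f \o a) one = y. Proof. by rewrite /= path_one. Qed.

Definition loop_map : {path I from y to y in Y} := mk_path map_cts map_zero map_one.
End path_map.

Lemma homotopic_map (a b : {path I from x to x in X}) :
  path_homotopic a b -> path_homotopic (loop_map a) (loop_map b).
Proof.
move=> [F [cF F0 F1 Fx Fy]]; exists (f \o F); split => [|s|s|t|t] /=.
- by move=> p; apply: continuous_comp; [exact: cF | exact: cts_fun].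
- by rewrite F0.
- by rewrite F1.
- by rewrite Fx.
- by rewrite Fy.
Qed.

(* The homomorphism of fundamental groups induced by the based map
   f : (X, x) -> (Y, y). *)
Definition pi1_map (u : pi1 x) : pi1 y := \pi_(pi1 y) (loop_map (repr u)).

Lemma pi1_mapE (a : {path I from x to x in X}) :
  pi1_map (\pi_(pi1 x) a) = \pi_(pi1 y) (loop_map a).
Proof. by apply/pi1P; apply: homotopic_map; exact: repr_pi1. Qed.

End induced_map.

End fundamental_group.

Arguments pi1_map {R X Y} f {x y} fx.

Section lpc0.
Variable R : realType.
Local Notation I := (unit_itv R).

(* Subsets rather than subspaces: a path in A is a path in X with values in A. *)
Definition path_connected_set (X : topologicalType) (A : set X) : Prop :=
  forall x y, A x -> A y ->
    exists a : {path I from x to y in X}, forall s, A (a s).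

Definition path_connected (X : topologicalType) : Prop :=
  path_connected_set [set: X].

Definition locally_path_connected (X : topologicalType) : Prop :=
  forall (x : X) (U : set X), nbhs x U ->
    exists V, [/\ open V, V x, V `<=` U & path_connected_set V].

Definition lpc0_covering (E X : topologicalType) (p : continuousType E X) : Prop :=
  [/\ path_connected E, locally_path_connected E &
      forall Y : topologicalType, path_connected Y -> locally_path_connected Y ->
      forall (e : E) (y : Y) (f : continuousType Y X) (fy : f y = p e),
        range (@pi1_map R _ _ f _ _ fy) `<=` range (@pi1_map R _ _ p e _ erefl) ->
        exists! g : Y -> E, [/\ continuous g, g y = e & p \o g = f]].

Definition lpc0_covering_subgroup (X : topologicalType) (x0 : X)
    (H : groupClosed (pi1 R x0)) : Prop :=
  exists (E : topologicalType) (e : E) (p : continuousType E X) (pe : p e = x0),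
    lpc0_covering p /\ range (pi1_map p pe) = [set` H].

Definition unique_path_lifting (E X : topologicalType) (f : E -> X) : Prop :=
  forall a b : continuousType I E, f \o a = f \o b -> a zero = b zero -> a = b.

End lpc0.

Section whisker_space.
Context {R : realType} {X : topologicalType} (x0 : X).
Local Notation I := (unit_itv R).

Record based_path := BasedPath {
  path_end : X;
  path_of : {path I from x0 to path_end in X} }.

HB.instance Definition _ := gen_eqMixin based_path.
HB.instance Definition _ := gen_choiceMixin based_path.

Lemma BasedPath_inj y (a b : {path I from x0 to y in X}) :
  BasedPath a = BasedPath b -> a = b.
Proof.
move=> e; have h t (e' : BasedPath a = t) :
    ecast z {path I from x0 to z in X} (congr1 path_end e') a = path_of t.
  by case: t / e'.
by rewrite -[RHS](h _ e) (eq_irrelevance (congr1 path_end e) erefl).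
Qed.

Variable H : groupClosed (pi1 R x0).

(* Quantifying over the common endpoint y makes a . b^- a loop by typing. *)
Definition whisker_rel (s t : based_path) : Prop :=
  exists (y : X) (a b : {path I from x0 to y in X}),
    [/\ s = BasedPath a, t = BasedPath b &
        \pi_(pi1 R x0) (path_cat a (path_rev b)) \in H].

Lemma whisker_relP y (a b : {path I from x0 to y in X}) :
  whisker_rel (BasedPath a) (BasedPath b) <->
  \pi_(pi1 R x0) (path_cat a (path_rev b)) \in H.
Proof.
split=> [[z [a' [b' [aa' bb']]]]|abH]; last by exists y, a, b.
move: (congr1 path_end aa') => /= yz; case: z / yz a' b' aa' bb' => a' b'.
by move=> /BasedPath_inj -> /BasedPath_inj ->.
Qed.

Lemma whisker_rel_end s t : whisker_rel s t -> path_end s = path_end t.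
Proof. by move=> [y [a [b [-> -> _]]]]. Qed.

Lemma whisker_rel_trans s t u :
  whisker_rel s t -> whisker_rel t u -> whisker_rel s u.
Proof.
case: s t u => [y a] [z b] [w c] ab bc.
move: (whisker_rel_end ab) (whisker_rel_end bc) => /= yz zw.
case: z / yz b zw ab bc => b yw; case: w / yw c => c.
move=> /whisker_relP abH /whisker_relP bcH; apply/whisker_relP.
suff -> : \pi_(pi1 R x0) (path_cat a (path_rev c)) =
    (\pi_(pi1 R x0) (path_cat a (path_rev b)) *
     \pi_(pi1 R x0) (path_cat b (path_rev c)))%g by exact: gpredM.
rewrite pi1M; apply/pi1P; apply: homotopic_sym.
apply: homotopic_trans (homotopic_catA _ _ _) _.
apply: homotopic_cat; first exact: homotopic_refl.
apply: homotopic_trans (homotopic_sym (homotopic_catA _ _ _)) _.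
apply: homotopic_trans (homotopic_cat1p _).
by apply: homotopic_cat; [exact: homotopic_catVp | exact: homotopic_refl].
Qed.

Lemma whisker_rel_refl s : whisker_rel s s.
Proof.
case: s => y a; apply/whisker_relP.
suff -> : \pi_(pi1 R x0) (path_cat a (path_rev a)) = 1%g by exact: gpred1.
by apply/pi1P; exact: homotopic_catpV.
Qed.

Lemma whisker_rel_sym s t : whisker_rel s t -> whisker_rel t s.
Proof.
move=> [y [a [b [-> -> abH]]]]; apply/whisker_relP.
have -> : path_cat b (path_rev a) = path_rev (path_cat a (path_rev b)).
  by rewrite path_rev_cat path_revK.
by rewrite -pi1V gpredV.
Qed.

Definition whisker_equiv : rel based_path := fun s t => `[< whisker_rel s t >].

Let whisker_equiv_refl : reflexive whisker_equiv.
Proof. by move=> s; apply/asboolP; exact: whisker_rel_refl. Qed.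

Let whisker_equiv_sym : symmetric whisker_equiv.
Proof. by move=> s t; apply/asboolP/asboolP; exact: whisker_rel_sym. Qed.

Let whisker_equiv_trans : transitive whisker_equiv.
Proof.
move=> t s u /asboolP st /asboolP tu; apply/asboolP.
exact: whisker_rel_trans st tu.
Qed.

Canonical whisker_equiv_rel :=
  EquivRel whisker_equiv whisker_equiv_refl whisker_equiv_sym whisker_equiv_trans.

Definition whisker : Type := {eq_quot whisker_equiv_rel}.
HB.instance Definition _ := Choice.on whisker.
HB.instance Definition _ := EqQuotient.on whisker.

Lemma whiskerP (s t : based_path) :
  (\pi_whisker s = \pi_whisker t) <-> whisker_rel s t.
Proof. by split=> [/eqmodP/asboolP|st]; last exact/eqmodP/asboolP. Qed.

Definition whisker_ball (s : based_path) (U : set X) : set whisker :=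
  [set u | exists (z : X) (e : {path I from path_end s to z in X}),
     (forall t, U (e t)) /\ u = \pi_whisker (BasedPath (path_cat (path_of s) e))].

(* Indexing by based paths instead of classes gives the same family of sets. *)
Definition whisker_subbase : set_system whisker :=
  [set B | exists (s : based_path) (U : set X),
     [/\ open U, U (path_end s) & B = whisker_ball s U]].

HB.instance Definition _ :=
  isSubBaseTopological.Build whisker whisker_subbase id.

Lemma open_whisker_ball s U :
  open U -> U (path_end s) -> open (whisker_ball s U).
Proof.
move=> oU Us; exists [set whisker_ball s U]; last by rewrite bigcup_set1.
by move=> _ ->; apply: finI_from1; exists s, U.
Qed.

Lemma whisker_ball_refl s U : U (path_end s) -> whisker_ball s U (\pi_whisker s).
Proof.
move=> Us; exists (path_end s), (path_cst (path_end s)); split => //.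
case: s Us => y a /= Us; apply/whiskerP/whisker_rel_sym/whisker_relP.
suff -> : \pi_(pi1 R x0) (path_cat (path_cat a (path_cst y)) (path_rev a)) = 1%g.
  exact: gpred1.
apply/pi1P; apply: homotopic_trans (homotopic_catpV a).
by apply: homotopic_cat; [exact: homotopic_catp1 | exact: homotopic_refl].
Qed.

(* The projection p_H; every representative of a class has the same endpoint. *)
Definition endpoint (u : whisker) : X := path_end (repr u).

Lemma endpointE s : endpoint (\pi_whisker s) = path_end s.
Proof. by apply: whisker_rel_end; apply/whiskerP; rewrite reprK. Qed.

Let continuous_endpoint : continuous endpoint.
Proof.
move=> + V; elim/quotW=> s; rewrite endpointE nbhsE => -[U [oU Us] UV].
rewrite nbhs_simpl/= nbhsE; exists (whisker_ball s U).
  by split; [exact: open_whisker_ball | exact: whisker_ball_refl].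
by move=> _ [z [e [eU ->]]]; apply: UV; rewrite endpointE/= -(path_one (s := e)).
Qed.

HB.instance Definition _ := isContinuous.Build whisker X endpoint continuous_endpoint.

Definition whisker_base : whisker := \pi_whisker (BasedPath (path_cst x0)).

Lemma endpoint_base : endpoint whisker_base = x0.
Proof. exact: endpointE. Qed.

End whisker_space.

(* Main.v *)
(* Implications (2) => (3) => (4) => (2) are the classical arguments: lifting along the
   interval gives unique path lifting, and the standard lifts t |-> [a|[0,t]] both
   compute the image of pi_1 and, under (4), describe every path of the whisker space.
   Trivially (2) and (4) give (1).  The remaining step is (1) => (4).  Given an lpc_0
   covering p : (E, e) -> (X, x0) with image H, sending [a] to the endpoint of the lift
   of a at e defines a map h from the whisker space to E over X; it is well defined by
   lifting homotopies along the square, and once h is known to be continuous, it carries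
   loops of the whisker space to loops of E, whose images lie in H.  A covering of this
   kind need not be open, so continuity of h is obtained by lifting a hedgehog: the
   space of all paths issuing from a point, joined at their origin so that a
   neighbourhood of the center contains every arm staying in some neighbourhood of that
   point.  This test space is path-connected, locally path-connected, and its map to X
   is trivial on pi_1. *)
Require Import Defs.
From HB Require Import structures.
From mathcomp Require Import all_boot all_order all_algebra generic_quotient.
From mathcomp Require Import finmap.
From mathcomp Require Import all_classical reals topology normedtype homotopy.
From mathcomp Require Import lra.

Set Implicit Arguments.
Unset Strict Implicit.
Unset Printing Implicit Defensive.

Import Order.TTheory GRing.Theory Num.Theory.
Import numFieldNormedType.Exports.

Local Open Scope classical_set_scope.
Local Open Scope ring_scope.
Local Open Scope quotient_scope.

(** * Continuity and paths in the unit interval *)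

Section continuity.
Context {S T U : topologicalType}.

Lemma continuous_pair (f : S -> T) (g : S -> U) :
  continuous f -> continuous g -> continuous (fun s => (f s, g s)).
Proof. by move=> cf cg s; apply: cvg_pair; [exact: cf | exact: cg]. Qed.

Lemma continuous_comp_fun (f : S -> T) (g : T -> U) :
  continuous f -> continuous g -> continuous (g \o f).
Proof. by move=> cf cg s; apply: continuous_comp; [exact: cf | exact: cg]. Qed.

End continuity.

Section unit_interval.
Context {R : realType}.
Local Notation I := (unit_itv R).

Lemma continuous_clampM (T : topologicalType) (f g : T -> R) :
  continuous f -> continuous g -> continuous (fun x => clamp (f x * g x)).
Proof.
move=> cf cg; apply: (@continuous_comp_fun _ R _ _ (@clamp R));
  last exact: continuous_clamp.
by move=> x; apply: cvgM; [exact: cf | exact: cg].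
Qed.

Lemma continuous_clamp_affine (T : topologicalType) (f : T -> R) (c d : R) :
  continuous f -> continuous (fun x => clamp ((1 - f x) * c + f x * d)).
Proof.
move=> cf; apply: (@continuous_comp_fun _ R _ _ (@clamp R));
  last exact: continuous_clamp.
move=> x; apply: cvgD; (apply: cvgM; last exact: cvg_cst); last exact: cf.
by apply: cvgB; [exact: cvg_cst | exact: cf].
Qed.

Definition itv_mul (s t : I) : I := clamp (itv_val s * itv_val t).

Lemma itv_valM s t : itv_val (itv_mul s t) = itv_val s * itv_val t.
Proof.
rewrite clamp_id ?mulr_ge0 ?itv_val_ge0//.
by rewrite -[leRHS]mulr1 ler_pM ?itv_val_ge0 ?itv_val_le1.
Qed.

Lemma itv_mul0 s : itv_mul s (zero : I) = zero.
Proof. by apply: itv_val_inj; rewrite itv_valM itv_val0 mulr0. Qed.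

Lemma itv_0mul t : itv_mul (zero : I) t = zero.
Proof. by apply: itv_val_inj; rewrite itv_valM itv_val0 mul0r. Qed.

Lemma itv_mul1 s : itv_mul s (one : I) = s.
Proof. by apply: itv_val_inj; rewrite itv_valM itv_val1 mulr1. Qed.

Lemma itv_1mul t : itv_mul (one : I) t = t.
Proof. by apply: itv_val_inj; rewrite itv_valM itv_val1 mul1r. Qed.

Lemma continuous_itv_mul (T : topologicalType) (f g : T -> I) :
  continuous f -> continuous g -> continuous (fun x => itv_mul (f x) (g x)).
Proof.
move=> cf cg; apply: continuous_clampM.
  exact: (continuous_comp_fun cf (@continuous_itv_val R)).
exact: (continuous_comp_fun cg (@continuous_itv_val R)).
Qed.

(** The affine path from [s] to [t] with parameter [r]. Precomposing with it cuts a path off at a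
    given time, or traverses a piece of it backwards when [t] is below [s]. *)
Definition segment (s t r : I) : I :=
  clamp ((1 - itv_val r) * itv_val s + itv_val r * itv_val t).

Lemma segment_val s t r :
  itv_val (segment s t r) = (1 - itv_val r) * itv_val s + itv_val r * itv_val t.
Proof.
have [s0 s1] := (itv_val_ge0 s, itv_val_le1 s).
have [t0 t1] := (itv_val_ge0 t, itv_val_le1 t).
have [r0 r1] := (itv_val_ge0 r, itv_val_le1 r).
by rewrite clamp_id//; nra.
Qed.

Lemma continuous_segment s t : continuous (segment s t).
Proof.
exact/continuous_clamp_affine/continuous_itv_val.
Qed.

Lemma segment0 s t : segment s t zero = s.
Proof. by apply: itv_val_inj; rewrite segment_val itv_val0 subr0 mul1r mul0r addr0. Qed.

Lemma segment1 s t : segment s t one = t.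
Proof. by apply: itv_val_inj; rewrite segment_val itv_val1 subrr mul1r mul0r add0r. Qed.

Definition segment_path s t : {path I from s to t in I} :=
  mk_path (@continuous_segment s t) (segment0 s t) (segment1 s t).

Lemma nbhs_itvP (s : I) (A : set I) : nbhs s A <->
  exists2 d : R, 0 < d & forall t : I, `|itv_val t - itv_val s| < d -> A t.
Proof.
split=> [[_ [[B oB <-] Bs BA]]|[d d0 dA]].
  have /nbhs_ballP[d /= d0 dB] : nbhs (itv_val s) B by exact: open_nbhs_nbhs.
  by exists d => // t st; apply/BA/dB; rewrite /ball/= distrC.
have : nbhs (itv_val s) (ball (itv_val s) d) by apply/nbhs_ballP; exists d.
move=> /(@continuous_itv_val R s); apply: (@filterS _ _ (nbhs_filter s)) => t.
by rewrite /preimage/= /ball/= distrC => /dA.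
Qed.

Lemma open_itv_gt0 : open [set t : I | 0 < itv_val t].
Proof.
apply: (open_comp (f := @itv_val R) (D := [set r | 0 < r])); last exact: open_gt.
by move=> t _; exact: continuous_itv_val.
Qed.

Lemma itv_gt0 (t : I) : t <> zero -> 0 < itv_val t.
Proof.
move=> t0; rewrite lt_neqAle itv_val_ge0 andbT eq_sym; apply/eqP => t0'.
by apply: t0; apply: itv_val_inj; rewrite t0' itv_val0.
Qed.

Lemma itv_le0 (t : I) : itv_val t <= itv_val (zero : I) -> t = zero.
Proof. by move=> t0; apply/itv_val_inj/le_anti; rewrite t0 itv_val0 itv_val_ge0. Qed.

Lemma path_connected_itv : path_connected R I.
Proof. by move=> s t _ _; exists (segment_path s t). Qed.

Lemma locally_path_connected_itv : locally_path_connected R I.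
Proof.
move=> s A /nbhs_itvP[d d0 dA].
exists [set t : I | `|itv_val t - itv_val s| < d]; split => //=.
- rewrite openE => t /= ts; apply/nbhs_itvP.
  exists (d - `|itv_val t - itv_val s|) => [|u /= ut]; first by rewrite subr_gt0.
  rewrite -(subrK (itv_val t) (itv_val u)) -addrA.
  by rewrite (le_lt_trans (ler_normD _ _))// -ltrBrDr.
- by rewrite subrr normr0.
- move=> t u; rewrite /= !ltr_norml => /andP[t1 t2] /andP[u1 u2].
  exists (segment_path t u) => r /=.
  rewrite segment_val ltr_norml.
  have [r0 r1] := (itv_val_ge0 r, itv_val_le1 r).
  case: (ltgtP (itv_val r) 0) r0 => // [r0|->] _; last first.
    by rewrite subr0 !mul1r !mul0r !addr0 t1 t2.
  by apply/andP; split; nra.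
Qed.

End unit_interval.

(** * Path-connectedness, images of paths, maps trivial on fundamental groups *)

Section connectedness.
Context {R : realType}.
Local Notation I := (unit_itv R).

Lemma path_connected_star (X : topologicalType) (A : set X) (c : X) :
  (forall x, A x -> exists a : {path I from c to x in X}, forall s, A (a s)) ->
  path_connected_set R A.
Proof.
move=> cA x y /cA[a aA] /cA[b bA]; exists (path_cat (path_rev a) b) => s.
by rewrite path_catE; case: ifP => _; [rewrite path_revE; exact: aA | exact: bA].
Qed.

Section path_image.
Context {X Y : topologicalType} (f : continuousType X Y) (x1 x2 : X) (y1 y2 : Y).
Hypotheses (fx1 : f x1 = y1) (fx2 : f x2 = y2).
Variable a : {path I from x1 to x2 in X}.

Let cts : continuous (f \o a).
Proof. by move=> s; apply: continuous_comp; exact: cts_fun. Qed.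

Let at0 : (f \o a) zero = y1. Proof. by rewrite /= path_zero. Qed.
Let at1 : (f \o a) one = y2. Proof. by rewrite /= path_one. Qed.

(** The endpoints [y1] and [y2] are tied to [f x1] and [f x2] only by equality proofs, so that
    images can be concatenated and compared with paths whose endpoints are not literally values of
    [f]. *)
Definition path_image : {path I from y1 to y2 in Y} := mk_path cts at0 at1.

Lemma path_imageE s : path_image s = f (a s). Proof. by []. Qed.

End path_image.

Lemma homotopic_path_image (X Y : topologicalType) (f : continuousType X Y)
    (x1 x2 : X) (y1 y2 : Y) (fx1 : f x1 = y1) (fx2 : f x2 = y2)
    (a b : {path I from x1 to x2 in X}) :
  path_homotopic a b -> path_homotopic (path_image fx1 fx2 a) (path_image fx1 fx2 b).
Proof.
move=> [F [cF F0 F1 Fx Fy]]; exists (f \o F); split => [|s|s|t|t] /=.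
- by move=> p; apply: continuous_comp; [exact: cF | exact: cts_fun].
- by rewrite F0.
- by rewrite F1.
- by rewrite Fx.
- by rewrite Fy.
Qed.

Lemma path_image_cat (X Y : topologicalType) (f : continuousType X Y)
    (x1 x2 x3 : X) (y1 y2 y3 : Y) (fx1 : f x1 = y1) (fx2 : f x2 = y2)
    (fx3 : f x3 = y3)
    (a : {path I from x1 to x2 in X}) (b : {path I from x2 to x3 in X}) :
  path_image fx1 fx3 (path_cat a b) =
  path_cat (path_image fx1 fx2 a) (path_image fx2 fx3 b).
Proof. by apply/path_eqP => s; rewrite path_imageE !path_catE; case: ifP. Qed.

Lemma path_image_rev (X Y : topologicalType) (f : continuousType X Y)
    (x1 x2 : X) (y1 y2 : Y) (fx1 : f x1 = y1) (fx2 : f x2 = y2)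
    (a : {path I from x1 to x2 in X}) :
  path_image fx2 fx1 (path_rev a) = path_rev (path_image fx1 fx2 a).
Proof. by apply/path_eqP. Qed.

Lemma loop_mapE (X Y : topologicalType) (f : continuousType X Y)
    (x : X) (y : Y) (fx : f x = y) (a : {path I from x to x in X}) :
  loop_map fx a = path_image fx fx a.
Proof. by apply/path_eqP. Qed.

Lemma path_connected_prod (X Y : topologicalType) (A : set X) (B : set Y) :
  path_connected_set R A -> path_connected_set R B ->
  path_connected_set R (A `*` B).
Proof.
move=> pA pB [x1 y1] [x2 y2] [/= Ax1 By1] [/= Ax2 By2].
have [a aA] := pA _ _ Ax1 Ax2; have [b bB] := pB _ _ By1 By2.
have cab : continuous (fun s : I => (a s, b s)).
  by apply: continuous_pair; exact: cts_fun.
have ab0 : (a zero, b zero) = (x1, y1) by rewrite !path_zero.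
have ab1 : (a one, b one) = (x2, y2) by rewrite !path_one.
by exists (mk_path cab ab0 ab1) => s; split => /=.
Qed.

Lemma locally_path_connected_prod (X Y : topologicalType) :
  locally_path_connected R X -> locally_path_connected R Y ->
  locally_path_connected R (X * Y)%type.
Proof.
move=> lX lY [x y] U [[A B] /= [/lX[A' [oA A'x A'A pA]] /lY[B' [oB B'y B'B pB]]] ABU].
exists (A' `*` B'); split => //.
- rewrite openE => -[u v] [/= A'u B'v]; exists (A', B') => //=.
  by split; exact: open_nbhs_nbhs.
- by move=> [u v] [/= /A'A ? /B'B ?]; apply: ABU.
- exact: path_connected_prod.
Qed.

(** Applied along a loop, a contraction of [f] fixing the image of the basepoint is a homotopy from
    the constant loop. It takes place in [X] rather than in [Y], so that the distinct points
    [(e, zero)] of a hedgehog may stay distinct. *)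
Lemma pi1_map_null (X Y : topologicalType) (f : continuousType Y X) (y : Y) (x : X)
    (fy : f y = x) (C : Y * I -> X) :
  continuous C -> (forall z, C (z, one) = f z) -> (forall z, C (z, zero) = x) ->
  (forall t, C (y, t) = x) ->
  forall u : pi1 R y, pi1_map f fy u = 1%g.
Proof.
move=> cC C1 C0 Cy; elim/quotW => a.
rewrite pi1_mapE pi1_1; apply/pi1P/homotopic_sym.
exists (fun p => C (a p.1, p.2)); split => [|s|s|t|t] /=.
- apply: (@continuous_comp_fun _ _ _ (fun p : I * I => (a p.1, p.2)) C _ cC).
  apply: continuous_pair; last by move=> ?; exact: cvg_snd.
  by apply: continuous_comp_fun; [move=> ?; exact: cvg_fst | exact: cts_fun].
- by rewrite C0.
- by rewrite C1.
- by rewrite path_zero.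
- by rewrite path_one.
Qed.

Lemma pi1_map_itv (X : topologicalType) (f : continuousType I X) (x : X)
    (f0 : f zero = x) (u : pi1 R (zero : I)) : pi1_map f f0 u = 1%g.
Proof.
apply: (@pi1_map_null _ _ _ _ _ _ (fun p => f (itv_mul p.1 p.2))) => [|s|s|t] /=.
- apply: continuous_comp_fun; last exact: cts_fun.
  by apply: continuous_itv_mul => ?; [exact: cvg_fst | exact: cvg_snd].
- by rewrite itv_mul1.
- by rewrite itv_mul0.
- by rewrite itv_0mul.
Qed.

Lemma pi1_map_square (X : topologicalType) (f : continuousType (I * I)%type X)
    (x : X) (f0 : f (zero, zero) = x) (u : pi1 R ((zero, zero) : I * I)) :
  pi1_map f f0 u = 1%g.
Proof.
apply: (@pi1_map_null _ _ _ _ _ _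
  (fun p => f (itv_mul p.1.1 p.2, itv_mul p.1.2 p.2))) => [|[s t]|[s t]|t] /=.
- apply: (@continuous_comp_fun _ _ _
    (fun p : (I * I) * I => (itv_mul p.1.1 p.2, itv_mul p.1.2 p.2)) f);
    last exact: cts_fun.
  apply: continuous_pair; apply: continuous_itv_mul; try by move=> ?; exact: cvg_snd.
    by apply: continuous_comp_fun => ?; exact: cvg_fst.
  by apply: (@continuous_comp_fun _ (I * I)%type) => ?; [exact: cvg_fst | exact: cvg_snd].
- by rewrite !itv_mul1.
- by rewrite !itv_mul0.
- by rewrite itv_0mul.
Qed.

End connectedness.

(** * Paths in the whisker space *)

Section whisker.
Context {R : realType} {X : topologicalType} (x0 : X) (H : groupClosed (pi1 R x0)).
Local Notation I := (unit_itv R).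
Local Notation W := (whisker H).

Definition whisker_class y (a : {path I from x0 to y in X}) : W :=
  \pi_(whisker H) (BasedPath a).
Local Notation cls := whisker_class.
Local Notation ball := (@whisker_ball R X x0 H).

Lemma whisker_classW (P : W -> Prop) :
  (forall y (a : {path I from x0 to y in X}), P (cls a)) -> forall u, P u.
Proof. by move=> Pcls; elim/quotW => -[y a]; exact: Pcls. Qed.

Lemma endpoint_class y (a : {path I from x0 to y in X}) : endpoint (cls a) = y.
Proof. exact: endpointE. Qed.

Lemma whisker_classP y (a b : {path I from x0 to y in X}) :
  cls a = cls b <-> \pi_(pi1 R x0) (path_cat a (path_rev b)) \in H.
Proof. by split => [/whiskerP/whisker_relP//|abH]; apply/whiskerP/whisker_relP. Qed.

Lemma whisker_class_homotopic y (a b : {path I from x0 to y in X}) :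
  path_homotopic a b -> cls a = cls b.
Proof.
move=> ab; apply/whisker_classP.
suff -> : \pi_(pi1 R x0) (path_cat a (path_rev b)) = 1%g by exact: gpred1.
apply/pi1P; apply: homotopic_trans (homotopic_catpV b).
by apply: homotopic_cat => //; exact: homotopic_refl.
Qed.

(** This turns membership in [H] into a closing condition: the standard lift of a loop ends at its
    class, hence closes up exactly when the loop lies in [H]. *)
Lemma whisker_class_loop (a : {path I from x0 to x0 in X}) :
  cls a = whisker_base H <-> \pi_(pi1 R x0) a \in H.
Proof.
have -> : \pi_(pi1 R x0) a = \pi_(pi1 R x0) (path_cat a (path_rev (path_cst x0))).
  apply/pi1P/homotopic_sym; apply: homotopic_trans (homotopic_catp1 a).
  apply: homotopic_cat; first exact: homotopic_refl.
  rewrite (_ : path_rev _ = path_cst x0); first exact: homotopic_refl.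
  exact/path_eqP.
exact: (@whisker_classP _ a (path_cst x0)).
Qed.

Lemma whisker_class_catA y z w (a : {path I from x0 to y in X})
    (b : {path I from y to z in X}) (c : {path I from z to w in X}) :
  cls (path_cat (path_cat a b) c) = cls (path_cat a (path_cat b c)).
Proof. exact/whisker_class_homotopic/homotopic_catA. Qed.

Lemma whisker_class_catp1 y (a : {path I from x0 to y in X}) :
  cls (path_cat a (path_cst y)) = cls a.
Proof. exact/whisker_class_homotopic/homotopic_catp1. Qed.

Lemma whisker_class_cat1p y (a : {path I from x0 to y in X}) :
  cls (path_cat (path_cst x0) a) = cls a.
Proof. exact/whisker_class_homotopic/homotopic_cat1p. Qed.

Lemma whisker_class_cat_homotopic y z (a : {path I from x0 to y in X})
    (b b' : {path I from y to z in X}) :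
  path_homotopic b b' -> cls (path_cat a b) = cls (path_cat a b').
Proof.
by move=> bb'; apply/whisker_class_homotopic/homotopic_cat => //; exact: homotopic_refl.
Qed.

(** In [(a c) (b c)^-] the middle factor [c c^-] contracts, which leaves [a b^-]. *)
Lemma whisker_class_cat y z (a b : {path I from x0 to y in X})
    (c : {path I from y to z in X}) :
  cls a = cls b -> cls (path_cat a c) = cls (path_cat b c).
Proof.
move=> /whisker_classP abH; apply/whisker_classP.
suff -> : \pi_(pi1 R x0) (path_cat (path_cat a c) (path_rev (path_cat b c))) =
          \pi_(pi1 R x0) (path_cat a (path_rev b)) by [].
apply/pi1P; rewrite path_rev_cat.
apply: homotopic_trans (homotopic_sym (homotopic_catA _ _ _)) _.
apply: homotopic_cat; last exact: homotopic_refl.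
apply: homotopic_trans (homotopic_catA _ _ _) _.
apply: homotopic_trans (homotopic_catp1 _).
by apply: homotopic_cat; [exact: homotopic_refl | exact: homotopic_catpV].
Qed.

Lemma whisker_ballP y (a : {path I from x0 to y in X}) (U : set X) (u : W) :
  ball (BasedPath a) U u <->
  exists z (e : {path I from y to z in X}),
    (forall t, U (e t)) /\ u = cls (path_cat a e).
Proof. by []. Qed.

(** If [[a] = [b e]], then [[a e'] = [b (e e')]], and [e e'] stays in [U] when [e] and [e'] do. *)
Lemma whisker_ball_recenter y (a : {path I from x0 to y in X})
    (s : based_path x0) (U : set X) :
  ball s U (cls a) ->
  ball (BasedPath a) U `<=` ball s U.
Proof.
case: s => z b /= [w [e [eU abe]]] u /whisker_ballP[v [e' [e'U ->]]].
have yw : w = y.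
  by have := congr1 (@endpoint R X x0 H) abe; rewrite endpoint_class endpointE.
case: y / yw a abe e' e'U => a abe e' e'U.
exists v, (path_cat e e'); split => [t|].
  by rewrite path_catE; case: ifP.
rewrite (whisker_class_cat _ abe); exact: whisker_class_catA.
Qed.

(** The balls are only declared to be a subbase. Once all balls of a finite intersection are
    recentered at [a], their open sets can be intersected, so the balls around [a] form a
    neighbourhood base. *)
Lemma nbhs_whiskerP y (a : {path I from x0 to y in X}) (A : set W) :
  nbhs (cls a) A <->
  exists U : set X, [/\ open U, U y & ball (BasedPath a) U `<=` A].
Proof.
split=> [[B [[D sD <-] [B' DB' B'a] BA]]|[U [oU Uy UA]]]; last first.
  rewrite nbhsE; exists (ball (BasedPath a) U) => //.
  by split; [exact: open_whisker_ball | exact: whisker_ball_refl].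
have [F sF FB'] : finI_from (@whisker_subbase R X x0 H) id B' by exact: sD.
have {B'a} B'a : B' (cls a) by [].
suff [U [oU Uy UF]] : exists U : set X, [/\ open U, U y &
    forall i, i \in enum_fset F -> ball (BasedPath a) U `<=` i].
  exists U; split => // u Uu; apply: BA; exists B' => //.
  suff : B' u by [].
  by rewrite -FB' => i /= iF; exact: UF Uu.
have {sF FB' B'a} : forall i, i \in enum_fset F -> whisker_subbase i /\ i (cls a).
  move=> i iF; split; first by have := sF i iF; rewrite inE.
  by move: B'a; rewrite -FB'; exact.
elim: (enum_fset F) => [|i l IHl] il; first by exists setT; split => //; exact: openT.
have [|V [oV Vy Vl]] := IHl; first by move=> j jl; apply: il; rewrite inE jl orbT.
have [[s [U [oU Us iE]]] ia] := il i (mem_head _ _).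
exists (U `&` V); split; first exact: openI.
  split => //; rewrite iE in ia; have [z [e [eU ae]]] := ia.
  have -> : y = z.
    by have := congr1 (@endpoint R X x0 H) ae; rewrite endpoint_class endpointE.
  by rewrite -(path_one (s := e)).
move=> j; rewrite inE => /orP[/eqP ->|jl].
  rewrite iE in ia *; apply: subset_trans (whisker_ball_recenter ia).
  by move=> u [z [e [eUV ->]]]; exists z, e; split => // t; have [] := eUV t.
apply: subset_trans (Vl j jl).
by move=> u [z [e [eUV ->]]]; exists z, e; split => // t; have [] := eUV t.
Qed.

(* Transporting the class of [a] along the images of paths of [Y] gives the lift. *)
Lemma whisker_lift (Y : topologicalType) (y : Y) (f : continuousType Y X) (x : X)
    (fy : f y = x) (a : {path I from x0 to x in X}) :
  path_connected R Y -> locally_path_connected R Y ->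
  (forall d : {path I from y to y in Y},
    cls (path_cat a (path_image fy fy d)) = cls a) ->
  exists g : continuousType Y W,
    forall z w (fz : f z = w) (d : {path I from y to z in Y}),
      g z = cls (path_cat a (path_image fy fz d)).
Proof.
move=> pY lY fd.
have d0 z : {path I from y to z in Y} by have /cid[] := pY y z Logic.I Logic.I.
pose g z := cls (path_cat a (path_image fy erefl (d0 z))).
(* The chosen path is immaterial: [d] followed by the reverse of [d0 z] is a loop at [y], and [fd]
   absorbs its image. *)
have gE z (d : {path I from y to z in Y}) :
    g z = cls (path_cat a (path_image fy erefl d)).
  rewrite /g -(whisker_class_cat _ (fd (path_cat d (path_rev (d0 z))))).
  rewrite whisker_class_catA; apply: whisker_class_cat_homotopic.
  rewrite -(path_image_cat fy fy erefl); apply: homotopic_path_image.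
  apply: homotopic_trans (homotopic_catA _ _ _) _.
  apply: homotopic_trans (homotopic_catp1 d).
  by apply: homotopic_cat; [exact: homotopic_refl | exact: homotopic_catVp].
have cg : continuous g.
  move=> z A /nbhs_whiskerP[U [oU Uz UA]].
  have /lY[V [oV Vz VU pV]] : nbhs z (f @^-1` U).
    by apply: (@cts_fun _ _ f z); exact: open_nbhs_nbhs.
  rewrite nbhs_simpl/=; apply: filterS (open_nbhs_nbhs (conj oV Vz)) => w /= Vw.
  (* The image of a path inside [V] stays in [U], so it is a whisker leading from [g z] to [g w]. *)
  have [d dV] := pV z w Vz Vw.
  apply: UA; exists (f w), (path_image erefl erefl d).
  split; first by move=> t; exact/VU/dV.
  rewrite (gE w (path_cat (d0 z) d)) (path_image_cat fy erefl erefl).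
  by apply: esym; exact: whisker_class_catA.
by exists (mkcts cg) => z w; case: w /.
Qed.

(** The lift is [t |-> [a . b|[0,t]]], an instance of [whisker_lift] on the interval, whose loops
    have null-homotopic images. The last clause serves to make the balls path-connected. *)
Lemma whisker_path_lift y z (a : {path I from x0 to y in X})
    (b : {path I from y to z in X}) :
  exists2 c : {path I from cls a to cls (path_cat a b) in W},
    @endpoint R X x0 H \o c = b &
    forall U : set X, (forall t, U (b t)) ->
      forall t, ball (BasedPath a) U (c t).
Proof.
have [d|g gE] := @whisker_lift I zero b y (path_zero (s := b)) a
  path_connected_itv locally_path_connected_itv.
  rewrite -[RHS]whisker_class_catp1; apply: whisker_class_cat_homotopic.
  apply/pi1P; rewrite -loop_mapE -pi1_mapE pi1_map_itv; exact: pi1_1.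
have g0 : g zero = cls a.
  rewrite (gE _ _ (path_zero (s := b)) (path_cst zero)) -[RHS]whisker_class_catp1.
  congr (cls (path_cat a _)); apply/path_eqP => t.
  by rewrite path_imageE /= path_zero.
have g1 : g one = cls (path_cat a b).
  rewrite (gE _ _ (path_one (s := b)) (segment_path zero one)).
  congr (cls (path_cat a _)); apply/path_eqP => t.
  rewrite path_imageE; congr (b _); apply: itv_val_inj.
  by rewrite segment_val itv_val0 itv_val1 mulr0 add0r mulr1.
exists (mk_path (@cts_fun _ _ g) g0 g1) => [|U bU t].
  by apply/funext => t /=; rewrite (gE _ _ erefl (segment_path zero t)) endpoint_class.
exists (b t), (path_image (path_zero (s := b)) erefl (segment_path zero t)).
by split; [move=> r; exact: bU | exact: gE].
Qed.

Lemma path_connected_whisker : path_connected R W.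
Proof.
apply: (@path_connected_star _ _ _ (whisker_base H)).
elim/whisker_classW => y a _.
have [c _ _] := whisker_path_lift (path_cst x0) a.
by rewrite whisker_class_cat1p in c; exists c.
Qed.

Lemma locally_path_connected_whisker : locally_path_connected R W.
Proof.
elim/whisker_classW => y a A /nbhs_whiskerP[U [oU Uy UA]].
exists (ball (BasedPath a) U); split => //.
- exact: open_whisker_ball.
- exact: whisker_ball_refl.
- apply: (@path_connected_star _ _ _ (cls a)) => _ [z [e [eU ->]]].
  by have [c _ cU] := whisker_path_lift a e; exists c; exact: cU.
Qed.

End whisker.

(** * Unique path lifting and the fundamental group *)

Section lifting.
Context {R : realType}.
Local Notation I := (unit_itv R).

Lemma pi1_map1 (X Y : topologicalType) (f : continuousType X Y) (x : X) (y : Y)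
    (fx : f x = y) : pi1_map f fx (1%g : pi1 R x) = 1%g.
Proof.
rewrite !pi1_1 pi1_mapE; congr (\pi_(pi1 R y) _).
by apply/path_eqP => t; exact: fx.
Qed.

(** The trivial subgroup lies in the image of [p], so the lifting criterion is met. *)
Lemma lpc0_covering_lift_null (E X Y : topologicalType) (p : continuousType E X)
    (e : E) (y : Y) (f : continuousType Y X) (fy : f y = p e) :
  lpc0_covering R p -> path_connected R Y -> locally_path_connected R Y ->
  (forall u : pi1 R y, pi1_map f fy u = 1%g) ->
  exists g : continuousType Y E, g y = e /\ p \o g = f.
Proof.
move=> [_ _ lift] pY lY f1.
have [|g [[cg gy pg] _]] := lift Y pY lY e y f fy.
  by move=> _ [u _ <-]; rewrite f1; exists 1%g => //; exact: pi1_map1.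
by exists (mkcts cg).
Qed.

(** Both paths lift the same map from the interval, whose loops have trivial image, so the
    uniqueness clause of the covering applies. *)
Lemma lpc0_covering_unique_path_lifting (E X : topologicalType)
    (p : continuousType E X) :
  lpc0_covering R p -> unique_path_lifting R p.
Proof.
move=> [_ _ lift] a b ab ab0.
have [|g [_ g_unique]] := lift I path_connected_itv locally_path_connected_itv
    (a zero) zero (p \o a) erefl.
  by move=> _ [u _ <-]; rewrite pi1_map_itv; exists 1%g => //; exact: pi1_map1.
apply/continuousEP => t.
rewrite -(g_unique a) ?(g_unique b)//; first by split => //; exact: cts_fun.
by split => //; exact: cts_fun.
Qed.

(** The points [w] and [x] coincide; only the equality proofs that type the loops change. *)
Lemma homotopic_path_image_base (X Y Z : topologicalType) (f : continuousType Y X)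
    (g : continuousType Z X) (y : Y) (z : Z) (w x : X)
    (fy : f y = w) (gz : g z = w) (fy' : f y = x) (gz' : g z = x)
    (d : {path I from y to y in Y}) (c : {path I from z to z in Z}) :
  path_homotopic (path_image fy fy d) (path_image gz gz c) ->
  path_homotopic (path_image fy' fy' d) (path_image gz' gz' c).
Proof.
case: w / fy gz => gz; case: x / fy' gz' => gz'.
by rewrite (Prop_irrelevance gz gz').
Qed.

End lifting.

(** * The covering criterion for the endpoint projection *)

Section whisker_lifting.
Context {R : realType} {X : topologicalType} (x0 : X) (H : groupClosed (pi1 R x0)).
Local Notation I := (unit_itv R).
Local Notation W := (whisker H).
Local Notation cls := (whisker_class H).
Local Notation p := (@endpoint R X x0 H).

Lemma whisker_standard_lift y (a : {path I from x0 to y in X}) :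
  exists c : {path I from whisker_base H to cls a in W},
    path_image (endpoint_base H) (endpoint_class H a) c = a.
Proof.
have [c pc _] := whisker_path_lift H (path_cst x0) a.
move: c pc; rewrite whisker_class_cat1p => c pc.
by exists c; apply/path_eqP => t; rewrite path_imageE -[RHS](congr1 (@^~ t) pc).
Qed.

Lemma subset_range_pi1_whisker : [set` H] `<=` range (pi1_map p (endpoint_base H)).
Proof.
elim/quotW => a /= aH; have [c ca] := whisker_standard_lift a.
have /whisker_class_loop ab := aH.
(* The end [cls a] equals the base class only propositionally; generalizing it to [u] retypes the
   standard lift as a loop. *)
have cu u (au : cls a = u) :
    exists c' : {path I from whisker_base H to u in W}, forall t, p (c' t) = a t.
  by case: u / au; exists c => t; rewrite -[in RHS]ca.
have [c' c'a] := cu _ ab; exists (\pi_(pi1 R (whisker_base H)) c') => //.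
by rewrite pi1_mapE; congr (\pi_(pi1 R x0) _); exact/path_eqP.
Qed.

(** By unique lifting, a loop at the base class is the standard lift of its projection. That lift
    ends at the class of the projection, which is therefore the base class. *)
Lemma unique_path_lifting_whisker : unique_path_lifting R p ->
  range (pi1_map p (endpoint_base H)) = [set` H].
Proof.
move=> upl; apply/seteqP; split; last exact: subset_range_pi1_whisker.
move=> _ [+ _ <-]; elim/quotW => c; rewrite pi1_mapE /=.
apply/whisker_class_loop.
have [b bc] := whisker_standard_lift (loop_map (endpoint_base H) c).
have bE : (b : continuousType I W) = c.
  apply: upl; last exact: etrans (path_zero (s := b)) (esym (path_zero (s := c))).
  apply/funext => t /=.
  by rewrite -[LHS](path_imageE (endpoint_base H) (endpoint_class H _)) bc.
have /= b1 := congr1 (fun g : continuousType I W => g one) bE.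
exact: etrans (esym (path_one (s := b))) (etrans b1 (path_one (s := c))).
Qed.

Hypothesis pH : range (pi1_map p (endpoint_base H)) `<=` [set` H].

(** Write [u] as [[d]]. The standard lift of [a], then [b], then the reversed standard lift of [d]
    form a loop at the base class. By [pH] its projection lies in [H], which says that [a] followed
    by the projection of [b] is equivalent to [d]. *)
Lemma whisker_path_end y (a : {path I from x0 to y in X}) (u : W) w
    (uw : p u = w) (b : {path I from cls a to u in W}) :
  u = cls (path_cat a (path_image (endpoint_class H a) uw b)).
Proof.
move: u uw b; apply: (@whisker_classW _ _ _ H) => z d zw.
have zw' : z = w by rewrite -zw endpoint_class.
case: w / zw' zw => zw b.
have [ca caE] := whisker_standard_lift a.
have [cd cdE] := whisker_standard_lift d.
apply/esym/whisker_classP/pH.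
exists (\pi_(pi1 R (whisker_base H)) (path_cat (path_cat ca b) (path_rev cd))) => //.
rewrite pi1_mapE loop_mapE (path_image_cat _ zw) path_image_rev.
rewrite (path_image_cat _ (endpoint_class H a)) caE.
by rewrite (Prop_irrelevance zw (endpoint_class H d)) cdE.
Qed.

Lemma lpc0_covering_whisker : lpc0_covering R p.
Proof.
split; [exact: path_connected_whisker | exact: locally_path_connected_whisker|].
move=> Y pY lY + y f; apply: (@whisker_classW _ _ _ H) => x a fy fp.
have fx : f y = x by exact: etrans fy (endpoint_class H a).
have [d|g gE] := @whisker_lift _ _ _ H Y y f x fx a pY lY.
  (* The image of [d] is homotopic to the projection of a loop [c] at [cls a], and
     [whisker_path_end] for [c] shows that appending this projection fixes [cls a]. *)
  have [|v _ vd] := fp (pi1_map f fy (\pi_(pi1 R y) d)).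
    by exists (\pi_(pi1 R y) d).
  elim/quotW: v vd => c; rewrite !pi1_mapE => /pi1P.
  rewrite !loop_mapE.
  move=> /(homotopic_path_image_base (endpoint_class H a) fx)/homotopic_sym dc.
  rewrite (whisker_class_cat_homotopic _ _ dc); apply: esym.
  exact: whisker_path_end.
exists g; split => [|g' [cg' g'y pg']].
  split; first exact: cts_fun.
    rewrite (gE _ _ fx (path_cst y)) -[RHS]whisker_class_catp1.
    by congr (cls (path_cat a _)); apply/path_eqP => t; rewrite path_imageE /= fx.
  apply/funext => z /=; have [d _] := pY y z Logic.I Logic.I.
  by rewrite (gE _ _ erefl d) endpoint_class.
(* Uniqueness: the end of [g' \o d] is determined by its projection, which is [f \o d]. *)
apply/funext => z; have [d _] := pY y z Logic.I Logic.I.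
have pg'z : p (g' z) = f z by rewrite -[RHS](congr1 (@^~ z) pg').
rewrite (gE _ _ erefl d).
rewrite [RHS](whisker_path_end pg'z (path_image (f := mkcts cg') g'y erefl d)).
congr (cls (path_cat a _)); apply/path_eqP => t.
by rewrite !path_imageE -[LHS](congr1 (@^~ (d t)) pg').
Qed.

End whisker_lifting.

(** * The hedgehog of paths issuing from a point *)

Section hedgehog.
Context {R : realType} {X : topologicalType} (x : X).
Local Notation I := (unit_itv R).

(* All the points [(e, 0)] are topologically indistinguishable: they play the role of
   the center, at which all the arms are joined. *)
Definition hedgehog : Type := (@based_path R X x * I)%type.

HB.instance Definition _ := Choice.copy hedgehog (@based_path R X x * I)%type.

(** An open set contains all the points [(e, zero)] or none. The uniform [U] makes the topology
    coarser than that of the wedge of arms: near the center all short arms are controlled at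
    once. *)
Definition hedgehog_open : set_system hedgehog := [set W |
  (forall e, open [set t | W (e, t)]) /\
  forall e, W (e, zero) -> (forall e', W (e', zero)) /\
    exists U : set X, [/\ open U, U x &
      forall e', (forall t, U (path_of e' t)) -> forall t, W (e', t)]].

Let hedgehog_openT : hedgehog_open setT.
Proof.
split=> [e|e _]; first exact: openT.
by split => //; exists setT; split => //; exact: openT.
Qed.

Let hedgehog_openI : setI_closed hedgehog_open.
Proof.
move=> A B [oA cA] [oB cB].
split => [e|e [/cA[A0 [U [oU Ux UA]]] /cB[B0 [V [oV Vx VB]]]]].
  exact: openI (oA e) (oB e).
split=> [e'|]; first by split.
exists (U `&` V); split => //; first exact: openI.
by move=> e' e'UV t; split; [apply: UA | apply: VB] => s; have [] := e'UV s.
Qed.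

Let hedgehog_open_bigU (J : Type) (F : J -> set hedgehog) :
  (forall j, hedgehog_open (F j)) -> hedgehog_open (\bigcup_j F j).
Proof.
move=> oF; split=> [e|e [j _ /(oF j).2[F0 [U [oU Ux UF]]]]].
  rewrite (_ : [set t | _] = \bigcup_j [set t | F j (e, t)]).
    by apply: bigcup_open => j _; exact: (oF j).1.
  by apply/seteqP; split.
split=> [e'|]; first by exists j.
by exists U; split => // e' e'U t; exists j => //; exact: UF.
Qed.

HB.instance Definition _ := isOpenTopological.Build hedgehog
  hedgehog_openT hedgehog_openI hedgehog_open_bigU.

Lemma hedgehog_openP (W : set hedgehog) : open W <-> hedgehog_open W.
Proof. by []. Qed.

Definition hedgehog_map (q : hedgehog) : X := path_of q.1 q.2.

Lemma continuous_hedgehog_map : continuous hedgehog_map.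
Proof.
apply/continuousP => U oU; apply/hedgehog_openP; split=> [e|e].
  by apply: (open_comp (f := path_of e)) => // t _; exact: cts_fun.
rewrite /hedgehog_map /= path_zero => Ux.
by split=> [e'|]; [rewrite path_zero | exists U].
Qed.

Definition hedgehog_center : hedgehog := (BasedPath (path_cst x), zero).

Lemma continuous_hedgehog_arm (e : @based_path R X x) :
  continuous (fun t : I => (e, t) : hedgehog).
Proof. by apply/continuousP => W /hedgehog_openP[oW _]; exact: oW. Qed.

Section spoke.
Variables (e : @based_path R X x) (s : I).

(** The value at [zero] is moved to the center so that all spokes have the same origin; [(e, zero)]
    is indistinguishable from it, which preserves continuity. *)
Definition spoke_fun (t : I) : hedgehog :=
  if t == zero then hedgehog_center else (e, itv_mul s t).

Let cts : continuous spoke_fun.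
Proof.
have c : continuous (fun t : I => (e, itv_mul s t) : hedgehog).
  have cs : continuous (itv_mul s).
    by apply: (@continuous_itv_mul _ _ (cst s) idfun); exact: cts_fun.
  exact: (continuous_comp_fun cs (@continuous_hedgehog_arm e)).
apply/continuousP => W oW; have /hedgehog_openP[_ cW] := oW.
rewrite (_ : _ @^-1` W = (fun t : I => (e, itv_mul s t) : hedgehog) @^-1` W).
  by move/continuousP : c; exact.
apply/seteqP; split => t /=; rewrite /spoke_fun; case: eqP => // ->; rewrite itv_mul0.
  by move=> /cW[W0 _]; exact: W0.
by move=> /cW[W0 _]; exact: W0.
Qed.

Let at0 : spoke_fun zero = hedgehog_center.
Proof. by rewrite /spoke_fun eqxx. Qed.

Let at1 : spoke_fun one = (e, s).
Proof.
by rewrite /spoke_fun eq_sym (negbTE (@clamp01_neq R)) itv_mul1.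
Qed.

Definition spoke : {path I from hedgehog_center to (e, s) : hedgehog in hedgehog} :=
  mk_path cts at0 at1.

Lemma spokeE t : spoke t = if t == zero then hedgehog_center else (e, itv_mul s t).
Proof. by []. Qed.

End spoke.

(** The star-shaped core of [W], which supplies path-connected neighbourhoods of the center. *)
Definition hedgehog_star (W : set hedgehog) : set hedgehog :=
  [set q | forall r : I, itv_val r <= itv_val q.2 -> W (q.1, r)].

Lemma hedgehog_star_sub W : hedgehog_star W `<=` W.
Proof. by move=> [e t] /(_ t); exact. Qed.

Lemma open_hedgehog_star W : open W -> open (hedgehog_star W).
Proof.
move=> /hedgehog_openP[oW cW]; apply/hedgehog_openP; split=> [e|e We].
  rewrite openE => t /= We.
  have /nbhs_itvP[d d0 dW] : nbhs t [set r | W (e, r)].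
    by apply: open_nbhs_nbhs; split => //; exact: We.
  apply/nbhs_itvP; exists d => // u tu r ru.
  (* A point [r] below [u] is either below [t], or between [t] and [u] and hence within [d] of
     [t]. *)
  have [rt|tr] := leP (itv_val r) (itv_val t); first exact: We.
  apply: dW; rewrite gtr0_norm ?subr_gt0//.
  by rewrite (le_lt_trans _ tu)// ler_normr lerB.
have [W0 [U [oU Ux UW]]] := cW e (hedgehog_star_sub We).
split => [e' r /= r0|]; last by exists U; split => // e' e'U t r _; exact: UW.
by rewrite (itv_le0 r0).
Qed.

Lemma path_connected_hedgehog_star W :
  hedgehog_star W hedgehog_center -> path_connected_set R (hedgehog_star W).
Proof.
move=> Wc; apply: (@path_connected_star _ _ _ hedgehog_center) => -[e s] Ws.
exists (spoke e s) => t; rewrite spokeE; case: eqP => // _ r /= rs.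
apply: Ws; apply: le_trans rs _ => /=.
by rewrite itv_valM ler_piMr ?itv_val_ge0 ?itv_val_le1.
Qed.

Lemma path_connected_hedgehog : path_connected R hedgehog.
Proof.
apply: (@path_connected_star _ _ _ hedgehog_center) => -[e s] _.
by exists (spoke e s).
Qed.

(** A set missing the center satisfies the second clause of [hedgehog_open] vacuously. *)
Lemma open_hedgehog_arm (e : @based_path R X x) (O : set I) :
  open O -> ~ O zero -> open ([set q | q.1 = e /\ O q.2] : set hedgehog).
Proof.
move=> oO O0; apply/hedgehog_openP; split=> [e'|e' [/= _ /O0]//].
have [->|ee'] := pselect (e' = e).
  by rewrite (_ : [set t | _] = O)//; apply/seteqP; split => // t [].
rewrite (_ : [set t | _] = set0); first exact: open0.
by apply/seteqP; split => // t [].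
Qed.

Lemma locally_path_connected_hedgehog : locally_path_connected R hedgehog.
Proof.
move=> [e t] A; rewrite nbhsE => -[W [oW Wet] WA].
have [t0|/itv_gt0 t0] := pselect (t = zero).
  rewrite t0 in Wet; have /hedgehog_openP[_ /(_ _ Wet)[W0 _]] := oW.
  have star0 e' : hedgehog_star W (e', zero).
    by move=> r /= r0; rewrite (itv_le0 r0).
  exists (hedgehog_star W); split.
  - exact: open_hedgehog_star.
  - by rewrite t0; exact: star0.
  - by move=> q /hedgehog_star_sub/WA.
  - by apply: path_connected_hedgehog_star; exact: star0.
have /locally_path_connected_itv[V [oV Vt VW pV]] :
    nbhs t ([set r | W (e, r)] `&` [set r | 0 < itv_val r]).
  apply: open_nbhs_nbhs; split => //; apply: openI; last exact: open_itv_gt0.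
  by have /hedgehog_openP[] := oW.
exists [set q | q.1 = e /\ V q.2]; split => //.
- by apply: open_hedgehog_arm => // /VW[_ /=]; rewrite itv_val0 ltxx.
- by move=> [e' r] /= [-> /VW[/WA]].
- move=> [e1 r] [e2 s] [/= -> Vr] [/= -> Vs]; have [a aV] := pV _ _ Vr Vs.
  pose arm := mkcts (@continuous_hedgehog_arm e).
  by exists (path_image (f := arm) erefl erefl a) => u; split => //; exact: aV.
Qed.

(** The map contracts to [x] along the arms. Joint continuity of this contraction is checked
    separately at the center and in the interior of a single arm. *)
Lemma pi1_map_hedgehog (y : X) (f : hedgehog_map hedgehog_center = y)
    (u : pi1 R hedgehog_center) :
  pi1_map (mkcts continuous_hedgehog_map) f u = 1%g.
Proof.
apply: (@pi1_map_null _ _ _ (mkcts continuous_hedgehog_map) hedgehog_center _ f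
  (fun p : hedgehog * I => path_of p.1.1 (itv_mul p.1.2 p.2))) => [|[e t]|[e t]|t] /=.
- move=> [[e t] s] A /=; rewrite nbhsE => -[U [oU Ue] UA].
  have [t0|/itv_gt0 t0] := pselect (t = zero).
    rewrite t0 itv_0mul path_zero in Ue.
    (* A star-shaped neighbourhood is stable under shrinking along the arms, so every deformation
       parameter is allowed. *)
    exists (hedgehog_star (hedgehog_map @^-1` U), setT); last first.
      move=> [[e' t'] s'] [/= Ue' _]; apply: UA; apply: Ue' => /=.
      by rewrite itv_valM ler_piMr ?itv_val_ge0 ?itv_val_le1.
    split; last exact: filterT.
    apply: open_nbhs_nbhs; split.
      apply: open_hedgehog_star; move/continuousP : continuous_hedgehog_map; exact.
    by move=> r /=; rewrite t0 => r0; rewrite /hedgehog_map /= (itv_le0 r0) path_zero.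
  have cF : continuous (fun p : I * I => path_of e (itv_mul p.1 p.2)).
    apply: continuous_comp_fun; last exact: cts_fun.
    by apply: continuous_itv_mul => ?; [exact: cvg_fst | exact: cvg_snd].
  have /(cF (t, s))[[B C] /= [Bt Cs] BC] : nbhs (path_of e (itv_mul t s)) U.
    exact: open_nbhs_nbhs.
  move: Bt; rewrite nbhsE => -[B' [oB' B't] B'B].
  have oB : open
      ([set q | q.1 = e /\ (B' `&` [set r | 0 < itv_val r]) q.2] : set hedgehog).
    apply: open_hedgehog_arm; first by apply: openI => //; exact: open_itv_gt0.
    by rewrite /= itv_val0 ltxx => -[].
  exists ([set q | q.1 = e /\ (B' `&` [set r | 0 < itv_val r]) q.2], C).
    by split => //=; apply: open_nbhs_nbhs; split.
  move=> [[e' t'] s'] [/= [-> [B't' _]] Cs']; apply: UA.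
  by apply: (BC (t', s')); split => //; exact: B'B.
- by rewrite itv_mul1.
- by rewrite itv_mul0 path_zero -f.
- by rewrite -f.
Qed.

End hedgehog.

(** * From a covering to the whisker space *)

Section covering_to_whisker.
Context {R : realType} {X E : topologicalType} (x0 : X) (H : groupClosed (pi1 R x0)).
Local Notation I := (unit_itv R).
Local Notation W := (whisker H).
Local Notation cls := (whisker_class H).
Variables (p : continuousType E X) (e : E) (pe : p e = x0).
Hypothesis covp : lpc0_covering R p.
Hypothesis pH : range (pi1_map p pe) = [set` H].

Definition lifts_to (s : @based_path R X x0) (w : E) : Prop :=
  exists g : continuousType I E, [/\ g zero = e, g one = w & p \o g = path_of s].

Lemma lifts_to_exists s : exists w, lifts_to s w.
Proof.
have s0 : path_of s zero = p e by rewrite path_zero pe.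
have [g [g0 pg]] := lpc0_covering_lift_null (f := path_of s) (fy := s0) covp
  path_connected_itv locally_path_connected_itv (pi1_map_itv _).
by exists (g one), g.
Qed.

Lemma lifts_to_unique s w w' : lifts_to s w -> lifts_to s w' -> w = w'.
Proof.
move=> [g [g0 <- pg]] [g' [g'0 <- pg']]; suff -> : g = g' by [].
by apply: (lpc0_covering_unique_path_lifting covp); [rewrite pg pg' | rewrite g0 g'0].
Qed.

(** Membership in [H] provides a loop [c] of [E] and a homotopy [F] from [p \o c] to [a b^-]. The
    lift [G] of [F] has bottom edge [c] and constant sides, so its top edge is a closed lift of
    [a b^-] at [e]. Its two halves, each read from [e], lift [a] and [b] and meet at the
    midpoint. *)
Lemma lifts_to_whisker_rel s t w w' :
  whisker_rel H s t -> lifts_to s w -> lifts_to t w' -> w = w'.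
Proof.
move=> [y [a [b [-> -> abH]]]] aw bw'.
have upl := lpc0_covering_unique_path_lifting covp.
have [+ _] : range (pi1_map p pe) (\pi_(pi1 R x0) (path_cat a (path_rev b))).
  by rewrite pH.
elim/quotW => c; rewrite pi1_mapE => /pi1P[F [cF F0 F1 Fl Fr]].
have F00 : mkcts cF (zero, zero) = p e by rewrite /mkcts Fl pe.
have pII : path_connected R (I * I)%type.
  rewrite /path_connected -setXTT.
  by apply: path_connected_prod; exact: path_connected_itv.
have [G [G00 pG]] := lpc0_covering_lift_null (fy := F00) covp pII
  (locally_path_connected_prod locally_path_connected_itv locally_path_connected_itv)
  (pi1_map_square _).
have pGE (q : I * I) : p (G q) = F q by have := congr1 (fun k => k q) pG.
have cbot : continuous (fun s : I => G (s, zero)).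
  apply: (@continuous_comp_fun _ _ _ (fun s : I => (s, zero : I)) G); last exact: cts_fun.
  apply: continuous_pair; first exact: (@cts_fun _ _ idfun).
  exact: (@cts_fun _ _ (cst zero)).
have cside (r : I) : continuous (fun t : I => G (r, t)).
  apply: (@continuous_comp_fun _ _ _ (fun t : I => (r, t)) G); last exact: cts_fun.
  apply: continuous_pair; first exact: (@cts_fun _ _ (cst r)).
  exact: (@cts_fun _ _ idfun).
have ctop : continuous (fun s : I => G (s, one)).
  apply: (@continuous_comp_fun _ _ _ (fun s : I => (s, one : I)) G); last exact: cts_fun.
  apply: continuous_pair; first exact: (@cts_fun _ _ idfun).
  exact: (@cts_fun _ _ (cst one)).
have G10 : G (one, zero) = e.
  have Gc : mkcts cbot = c :> continuousType I E.
    apply: upl; last exact: etrans G00 (esym (path_zero (s := c))).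
    by apply/funext => s'; exact: etrans (pGE _) (F0 s').
  exact: etrans (congr1 (fun g : continuousType I E => g one) Gc) (path_one (s := c)).
have Gside (r : I) : G (r, zero) = e -> (forall t, F (r, t) = x0) -> G (r, one) = e.
  move=> Gr Fr0; have Gc : mkcts (cside r) = cst e :> continuousType I E.
    apply: upl; last exact: Gr.
    by apply/funext => t'; rewrite /= pe; exact: etrans (pGE _) (Fr0 t').
  by have := congr1 (fun g : continuousType I E => g one) Gc; rewrite /mkcts.
have G01 := Gside zero G00 Fl; have G11 := Gside one G10 Fr.
pose half : I := clamp 2^-1.
have half2 : itv_val half = 2^-1 by rewrite clamp_id//; lra.
have cE (u v : I) : continuous (fun r => G (segment u v r, one)).
  exact: (continuous_comp_fun (@continuous_segment R u v) ctop).
have aG : lifts_to (BasedPath a) (G (half, one)).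
  exists (mkcts (cE zero half)); split; rewrite /= /mkcts ?segment0 ?segment1 //.
  apply/funext => r /=; rewrite pGE F1 path_catE segment_val itv_val0 half2.
  have [r0 r1] := (itv_val_ge0 r, itv_val_le1 r).
  rewrite ifT; last by lra.
  by rewrite (_ : 2 * _ = itv_val r) ?clampK//; lra.
have bG : lifts_to (BasedPath b) (G (half, one)).
  exists (mkcts (cE one half)); split; rewrite /= /mkcts ?segment0 ?segment1 //.
  apply/funext => r /=; rewrite pGE F1 path_catE segment_val itv_val1 half2.
  have [r0 r1] := (itv_val_ge0 r, itv_val_le1 r).
  (* Time [r] corresponds to the point [1 - r/2] of the top edge, so the first branch of the
     concatenation occurs only at [r = one], where [a] and [b] both have value [y]. *)
  case: ifP => r2.
    have -> : r = one by apply/itv_val_inj/le_anti; rewrite itv_val1 r1 /=; lra.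
    by rewrite clamp_ge1 ?path_one//; rewrite itv_val1; lra.
  rewrite path_revE clamp_id; [|lra|lra].
  by rewrite (_ : 1 - _ = itv_val r) ?clampK//; lra.
by rewrite (lifts_to_unique aw aG) (lifts_to_unique bw' bG).
Qed.

Definition whisker_to_covering (u : W) : E := projT1 (cid (lifts_to_exists (repr u))).
Local Notation h := whisker_to_covering.

Lemma whisker_to_coveringE s w : lifts_to s w -> h (\pi_(whisker H) s) = w.
Proof.
rewrite /h; case: cid => w' /= rw' sw.
apply: lifts_to_whisker_rel rw' sw.
by apply/whiskerP; rewrite reprK.
Qed.

Lemma lifts_to_end y (a : {path I from x0 to y in X}) w :
  lifts_to (BasedPath a) w -> p w = y.
Proof.
move=> [g [_ <- pg]]; have /= -> := congr1 (@^~ one) pg.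
exact: path_one.
Qed.

Lemma whisker_to_coveringK u : p (h u) = endpoint u.
Proof.
move: u; apply: (@whisker_classW _ _ _ H) => y a.
have [w aw] := lifts_to_exists (BasedPath a).
by rewrite (whisker_to_coveringE aw) (lifts_to_end aw) endpoint_class.
Qed.

Lemma whisker_to_covering_base : h (whisker_base H) = e.
Proof.
apply: whisker_to_coveringE; exists (cst e); split => //.
by apply/funext => t /=.
Qed.

(* The paths issuing from the endpoint of [a] are lifted simultaneously, as the arms of
   one hedgehog: continuity of that lift at the center puts the lifts of all short arms
   in a given neighbourhood. *)
Lemma continuous_whisker_to_covering : continuous h.
Proof.
apply: (@whisker_classW _ _ _ H) => x a A.
have [w aw] := lifts_to_exists (BasedPath a).
rewrite (whisker_to_coveringE aw) nbhs_simpl /= => Aw.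
have fw : mkcts (@continuous_hedgehog_map R X x) (hedgehog_center x) = p w.
  by rewrite (lifts_to_end aw).
have [g [gc pg]] := lpc0_covering_lift_null (fy := fw) covp
  (@path_connected_hedgehog R X x) (@locally_path_connected_hedgehog R X x)
  (pi1_map_hedgehog _).
have : nbhs (hedgehog_center x) (g @^-1` A).
  by apply: (@cts_fun _ _ g (hedgehog_center x)); rewrite gc.
rewrite nbhsE => -[O [/hedgehog_openP[_ cO] Oc] OA].
have [_ [U [oU Ux UO]]] := cO _ Oc.
apply/nbhs_whiskerP; exists U; split => // _ [z [c [cU ->]]] /=.
have [ga [ga0 ga1 pga]] := aw.
have gcc : g (hedgehog_center x) = ga one by rewrite gc ga1.
pose a' : {path I from e to ga one in E} := mk_path (@cts_fun _ _ ga) ga0 erefl.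
(* On the arm indexed by [c], the map [g] restricts to a lift of [c] starting at [w]; appended to
   the lift of [a], it gives a lift of [a c]. *)
pose c' := path_image (f := g) gcc erefl (spoke (BasedPath c) one).
have ac : lifts_to (BasedPath (path_cat a c)) (g (BasedPath c, one)).
  pose ac := path_cat a' c'.
  exists ac; split; [exact: (path_zero (s := ac)) | exact: (path_one (s := ac)) |].
  apply/funext => t; rewrite -[LHS]/(p (path_cat a' c' t)) -[RHS]/(path_cat a c t).
  rewrite !path_catE; case: ifP => _.
    exact: (congr1 (fun k : I -> X => k (clamp (2 * itv_val t))) pga).
  set r := clamp _.
  apply: etrans (congr1 (fun k : hedgehog x -> X =>
    k (spoke (BasedPath c) one r)) pg) _.
  (* At [zero] the spoke sits at the center rather than on the arm of [c]; the center maps to [x],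
     where [c] starts. *)
  rewrite /= /mkcts spokeE; case: eqP => [->|_]; first exact: esym (path_zero (s := c)).
  by rewrite /hedgehog_map /= itv_1mul.
rewrite (whisker_to_coveringE ac); exact/OA/UO.
Qed.

(** The map [h] carries a loop at the base class to a loop at [e] with the same projection. *)
Lemma range_pi1_whisker_sub :
  range (pi1_map (@endpoint R X x0 H) (endpoint_base H)) `<=` [set` H].
Proof.
move=> _ [+ _ <-]; elim/quotW => c; rewrite -pH pi1_mapE.
pose hc := path_image (f := mkcts continuous_whisker_to_covering)
  whisker_to_covering_base whisker_to_covering_base c.
exists (\pi_(pi1 R e) hc) => //; rewrite pi1_mapE; congr (\pi_(pi1 R x0) _).
by apply/path_eqP => t; exact: whisker_to_coveringK.
Qed.

End covering_to_whisker.

(** * Closing the cycle of implications *)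

Theorem theorem57 (R : realType) (X : topologicalType) (x0 : X)
    (HX : path_connected R X) (H : groupClosed (pi1 R x0)) :
  [<-> (* 1 *) lpc0_covering_subgroup H;
       (* 2 *) lpc0_covering R (@endpoint R X x0 H);
       (* 3 *) unique_path_lifting R (@endpoint R X x0 H);
       (* 4 *) range (pi1_map (@endpoint R X x0 H) (endpoint_base H)) = [set` H]].
Proof.
tfae.
- move=> [E [e [p [pe [covp pH]]]]].
  (* The passage from (1) to (2) goes through the inclusion of the image in [H], one half of (4). *)
  exact/lpc0_covering_whisker/(range_pi1_whisker_sub covp pH).
- exact: lpc0_covering_unique_path_lifting.
- exact: unique_path_lifting_whisker.
- move=> pH; exists (whisker H), (whisker_base H), (@endpoint R X x0 H).
  exists (endpoint_base H).
  by split => //; apply: lpc0_covering_whisker; rewrite pH.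
Qed.
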